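(* Let $n$ be a positive integer, $0<p\le 2$ and $0<\alpha\le 1$, and let $A$ be a (nonempty) compact subset of $\bigl(\ell_p^n\bigr)^\alpha$. Then there is a constant $C>0$ such that $|tA| \le C t^{n/\beta}$ for all $t\ge 1$, where $\beta = \alpha\min\{1,p\}$.
   Context: $\bigl(\ell_p^n\bigr)^\alpha$ denotes $\mathbb{R}^n$ with the metric $d(x,y)=\|x-y\|_p^{\alpha\min\{1,p\}}$, where $\|x\|_p = \bigl(\sum_{j=1}^n |x_j|^p\bigr)^{1/p}$. For a metric space $A=(A,d)$ and $t>0$, $tA$ denotes the metric space $(A,td)$ (the same set with the metric rescaled). A metric space is positive definite if for each of its nonempty finite subsets $B$ the matrix $[e^{-d(x,y)}]_{x,y\in B}$ is positive definite; the spaces $t\bigl(\ell_p^n\bigr)^\alpha$ with $t>0$, $0<p\le2$, $0<\alpha\le1$ are positive definite. The magnitude of a compact positive definite metric space $(A,d)$ is $|A| = \sup\{\mu(A)^2/Z_A(\mu,\mu) : \mu\in M(A),\ Z_A(\mu,\mu)\neq 0\}\in[1,\infty]$, where $M(A)$ is the space of finite signed Borel measures on $A$ and $Z_A(\mu,\nu)=\int_A\int_A e^{-d(x,y)}\,d\mu(x)\,d\nu(y)$. *)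

(* Defs.v *)
From HB Require Import structures.
From mathcomp Require Import all_boot all_order all_algebra.
From mathcomp Require Import all_classical all_reals all_analysis.
From mathcomp Require Import ring.

Set Implicit Arguments.
Unset Strict Implicit.
Unset Printing Implicit Defensive.

Import Order.TTheory GRing.Theory Num.Theory.
Import numFieldNormedType.Exports.

Local Open Scope classical_set_scope.
Local Open Scope ring_scope.

(* A subset of a metric space, as a metric space: [set_type A] already carries
   the induced pseudometric structure in the library. *)
Section submetric.
Context {R : realType} {X : metricType R} (A : set X).

Let sdist (x y : A) : R := mdist (set_val x) (set_val y).

Let sdist_ge0 x y : 0 <= sdist x y.
Proof. exact: mdist_ge0. Qed.

Let sdist_positivity x y : sdist x y = 0 -> x = y.
Proof. by move=> /mdist_positivity; exact: val_inj. Qed.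

Let ballEsdist (x : A) d : ball x d = [set y | sdist x y < d].
Proof. by rewrite -initial_ballE ballEmdist. Qed.

HB.instance Definition _ :=
  @PseudoMetric_isMetric.Build R (set_type A) sdist
    sdist_ge0 sdist_positivity ballEsdist.

Lemma sub_mdistE (x y : A) : mdist x y = mdist (set_val x) (set_val y).
Proof. by []. Qed.
End submetric.

(* The rescaled metric space tX. *)
Definition scaled (R : realType) (t : R) (t_gt0 : 0 < t) (X : metricType R) :
  Type := X.

Section scaled_metric.
Context {R : realType} (t : R) (t_gt0 : 0 < t) (X : metricType R).

Let tdist (x y : X) : R := t * mdist x y.

Let tdistxx x : tdist x x = 0.
Proof. by rewrite /tdist mdistxx mulr0. Qed.

Let tdist_positivity x y : tdist x y = 0 -> x = y.
Proof.
by move/eqP; rewrite mulf_eq0 gt_eqF//= => /eqP/mdist_positivity.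
Qed.

Let tdist_sym x y : tdist x y = tdist y x.
Proof. by rewrite /tdist metric_sym. Qed.

Let tdist_triangle y x z : tdist x z <= tdist x y + tdist y z.
Proof. by rewrite /tdist -mulrDr ler_pM2l// metric_triangle. Qed.

HB.instance Definition _ := Choice.on (scaled t_gt0 X).
HB.instance Definition _ := @isMetric.Build R (scaled t_gt0 X) tdist
  tdistxx tdist_positivity tdist_sym tdist_triangle.

Lemma scaled_mdistE (x y : scaled t_gt0 X) :
  mdist x y = t * mdist (x : X) (y : X).
Proof. by []. Qed.
End scaled_metric.

Section lp_norm.
Context {R : realType} (n : nat).
Implicit Types (p a : R) (x y : 'rV[R]_n).

(* A quasinorm only, when p < 1. *)
Definition lp_norm p x : R := (\sum_(j < n) `|x ord0 j| `^ p) `^ p^-1.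

Lemma lp_norm_ge0 p x : 0 <= lp_norm p x.
Proof. exact: powR_ge0. Qed.

Lemma powR_subadd a (u v : R) : 0 < a -> a <= 1 -> 0 <= u -> 0 <= v ->
  (u + v) `^ a <= u `^ a + v `^ a.
Proof.
move=> a0 a1 u0 v0; have [uv0|uv0] := eqVneq (u + v) 0.
  by rewrite uv0 powR0 ?gt_eqF// addr_ge0// powR_ge0.
have s0 : 0 < u + v by rewrite lt_neqAle eq_sym uv0 addr_ge0.
have key w : 0 <= w -> w <= u + v -> w / (u + v) * (u + v) `^ a <= w `^ a.
  move=> w0 ws; have [->|wn0] := eqVneq w 0.
    by rewrite mul0r mul0r powR_ge0.
  have wp : 0 < w by rewrite lt_neqAle eq_sym wn0.
  have -> : w `^ a = (w / (u + v)) `^ a * (u + v) `^ a.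
    by rewrite -powRM ?divr_ge0 ?(ltW s0)// divfK.
  rewrite ler_wpM2r ?powR_ge0// ger1_powR//.
  by rewrite divr_gt0// ler_pdivrMr// mul1r.
apply: le_trans (lerD (key u u0 _) (key v v0 _)); rewrite ?lerDl ?lerDr//.
by rewrite -mulrDl -mulrDl divff// mul1r.
Qed.

Lemma powR_normD p (u v : R) : 0 < p ->
  `|u + v| `^ p <= (`|u| + `|v|) `^ p.
Proof.
move=> p0; apply: ge0_ler_powR.
- exact: ltW.
- by rewrite nnegrE normr_ge0.
- by rewrite nnegrE addr_ge0 ?normr_ge0.
- exact: ler_normD.
Qed.

Lemma lp_norm0 p : 0 < p -> lp_norm p 0 = 0.
Proof.
move=> p0; rewrite /lp_norm big1 ?powR0 ?invr_eq0 ?gt_eqF// => j _.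
by rewrite mxE normr0 powR0// gt_eqF.
Qed.

Lemma lp_norm_eq0 p x : 0 < p -> lp_norm p x = 0 -> x = 0.
Proof.
move=> p0 /powR_eq0_eq0/eqP; rewrite psumr_eq0; last by move=> *; exact: powR_ge0.
move=> /allP x0; apply/rowP => j; rewrite mxE.
by have /eqP/powR_eq0_eq0/normr0_eq0 := x0 j (mem_index_enum j).
Qed.

Lemma lp_normN p x : lp_norm p (- x) = lp_norm p x.
Proof. by congr (_ `^ _); apply: eq_bigr => j _; rewrite mxE normrN. Qed.

Lemma lp_norm_powR p x : 0 < p ->
  lp_norm p x `^ p = \sum_(j < n) `|x ord0 j| `^ p.
Proof.
move=> p0; rewrite /lp_norm -powRrM mulVf ?gt_eqF// powRr1//.
by apply: sumr_ge0 => j _; exact: powR_ge0.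
Qed.

Lemma lp_norm_le1_triangle p x y : 0 < p -> p <= 1 ->
  lp_norm p (x + y) `^ p <= lp_norm p x `^ p + lp_norm p y `^ p.
Proof.
move=> p0 p1; rewrite [leLHS](lp_norm_powR (x + y) p0).
rewrite [X in _ <= X + _](lp_norm_powR x p0).
rewrite [X in _ <= _ + X](lp_norm_powR y p0).
rewrite -big_split/=; apply: ler_sum => j _.
apply: le_trans (powR_subadd p0 p1 (normr_ge0 _) (normr_ge0 _)).
by rewrite mxE; exact: powR_normD.
Qed.

Lemma lp_norm_triangle p x y : 1 <= p ->
  lp_norm p (x + y) <= lp_norm p x + lp_norm p y.
Proof.
move=> p1; have p0 : 0 < p by exact: lt_le_trans p1.
have [/(lp_norm_eq0 p0) ->|A0] := eqVneq (lp_norm p x) 0.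
  by rewrite add0r lerDr lp_norm_ge0.
have [/(lp_norm_eq0 p0) ->|B0] := eqVneq (lp_norm p y) 0.
  by rewrite addr0 lerDl lp_norm_ge0.
have u0 : 0 < lp_norm p x by rewrite lt_neqAle eq_sym A0 lp_norm_ge0.
have v0 : 0 < lp_norm p y by rewrite lt_neqAle eq_sym B0 lp_norm_ge0.
move Eu : (lp_norm p x) A0 u0 => u A0 u0.
move Ev : (lp_norm p y) B0 v0 => v B0 v0.
have s0 : 0 < u + v := addr_gt0 u0 v0.
have pinj := @gt0_ltr_powR R p p0.
rewrite leNgt; apply/negP => /pinj.
rewrite !nnegrE lp_norm_ge0 (ltW s0) => /(_ isT isT).
apply/negP; rewrite -leNgt [leLHS](lp_norm_powR (x + y) p0).
have l0 : 0 <= u / (u + v) by apply: divr_ge0; exact: ltW.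
have l1 : u / (u + v) <= 1 by rewrite ler_pdivrMr// mul1r lerDl ltW.
have l2 : 1 - u / (u + v) = v / (u + v).
  by rewrite -[X in X - _](divff (lt0r_neq0 s0)) -mulrBl addrAC subrr add0r.
have l2' : unstable.onem (u / (u + v)) = v / (u + v) by [].
have step j : `|(x + y) ord0 j| `^ p <=
    (u + v) `^ p * (u / (u + v) * (`|x ord0 j| / u) `^ p
                   + v / (u + v) * (`|y ord0 j| / v) `^ p).
  have := @convex_powR R p p1 (Itv01 l0 l1) (`|x ord0 j| / u) (`|y ord0 j| / v).
  have xu : 0 <= `|x ord0 j| / u by apply: divr_ge0 => //; exact: ltW.
  have yv : 0 <= `|y ord0 j| / v by apply: divr_ge0 => //; exact: ltW.
  rewrite !inE/= !in_itv/= !andbT => /(_ xu yv).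
  move=> H; rewrite convRE [X in X `^ _ <= _]convRE /= l2' in H.
  apply: le_trans (ler_wpM2l (powR_ge0 _ _) H).
  have l0' : 0 <= v / (u + v) by apply: divr_ge0; exact: ltW.
  rewrite -powRM; first last.
  - by apply: addr_ge0; apply: mulr_ge0.
  - exact: ltW.
  have -> : (u + v) * (u / (u + v) * (`|x ord0 j| / u)
      + v / (u + v) * (`|y ord0 j| / v)) = `|x ord0 j| + `|y ord0 j|.
    by field; rewrite A0 B0 gt_eqF.
  by rewrite mxE; exact: powR_normD.
apply: le_trans (ler_sum _ (fun j _ => step j)) _.
rewrite -mulr_sumr big_split/= -!mulr_sumr.
have nrm (z : 'rV[R]_n) (w : R) : w = lp_norm p z -> 0 < w ->
    \sum_(j < n) (`|z ord0 j| / w) `^ p = 1.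
  move=> wz w0.
  under eq_bigr do rewrite powRM ?invr_ge0 ?(ltW w0)//.
  rewrite -mulr_suml -(lp_norm_powR z p0) -wz -powRM ?invr_ge0 ?(ltW w0)//.
  by rewrite divff ?powR1// gt_eqF.
rewrite (nrm x u (esym Eu) u0) (nrm y v (esym Ev) v0) !mulr1 -mulrDl divff ?mulr1//.
by rewrite gt_eqF.
Qed.

End lp_norm.

(* The space (l_p^n)^a. The hypotheses on p and a are arguments of the type since
   the distance below is a metric only under them. *)
Definition lp_space (R : realType) (n : nat) (p a : R)
  (p_gt0 : 0 < p) (a_gt0 : 0 < a) (a_le1 : a <= 1) : Type := 'rV[R]_n.

Section lp_space_metric.
Context {R : realType} (n : nat) (p a : R).
Context (p_gt0 : 0 < p) (a_gt0 : 0 < a) (a_le1 : a <= 1).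

Definition lp_dist (x y : 'rV[R]_n) : R := lp_norm p (x - y) `^ (a * Num.min 1 p).

Let beta_gt0 : 0 < a * Num.min 1 p.
Proof. by rewrite mulr_gt0// lt_min ltr01. Qed.

Let ldistxx x : lp_dist x x = 0.
Proof. by rewrite /lp_dist subrr lp_norm0// powR0// gt_eqF. Qed.

Let ldist_positivity x y : lp_dist x y = 0 -> x = y.
Proof. by move=> /powR_eq0_eq0/(lp_norm_eq0 p_gt0)/eqP; rewrite subr_eq0 => /eqP. Qed.

Let ldist_sym x y : lp_dist x y = lp_dist y x.
Proof. by rewrite /lp_dist -lp_normN opprB. Qed.

Let ldist_triangle y x z : lp_dist x z <= lp_dist x y + lp_dist y z.
Proof.
have split_pow (w : 'rV[R]_n) : lp_norm p w `^ (a * Num.min 1 p) =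
    (lp_norm p w `^ Num.min 1 p) `^ a by rewrite mulrC powRrM.
rewrite /lp_dist [leLHS]split_pow [X in _ <= X + _]split_pow.
rewrite [X in _ <= _ + X]split_pow.
apply: le_trans (powR_subadd a_gt0 a_le1 (powR_ge0 _ _) (powR_ge0 _ _)).
apply: ge0_ler_powR; [exact: ltW | exact: powR_ge0 | |].
  by rewrite nnegrE; apply: addr_ge0; exact: powR_ge0.
have -> : x - z = (x - y) + (y - z) by rewrite addrA subrK.
have [p1|p1] := leP 1 p; last first.
  exact: (@lp_norm_le1_triangle R n p _ _ p_gt0 (ltW p1)).
have nr1 (w : 'rV[R]_n) : lp_norm p w `^ 1 = lp_norm p w.
  by rewrite powRr1 // lp_norm_ge0.
rewrite [leLHS]nr1 [X in _ <= X + _]nr1 [X in _ <= _ + X]nr1.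
exact: (@lp_norm_triangle R n p _ _ p1).
Qed.

HB.instance Definition _ := Choice.on (lp_space n p_gt0 a_gt0 a_le1).
HB.instance Definition _ :=
  @isMetric.Build R (lp_space n p_gt0 a_gt0 a_le1) lp_dist
  ldistxx ldist_positivity ldist_sym ldist_triangle.

Lemma lp_mdistE (x y : lp_space n p_gt0 a_gt0 a_le1) :
  mdist x y = lp_norm p ((x : 'rV[R]_n) - y) `^ (a * Num.min 1 p).
Proof. reflexivity. Qed.
End lp_space_metric.

(* Measurable types are pointed in the library: [pointed_at x0] is T pointed by
   x0, which has no influence on the measurable sets. *)
Definition pointed_at (T : Type) (x0 : T) : Type := T.
HB.instance Definition _ (T : choiceType) (x0 : T) := Choice.on (pointed_at x0).
HB.instance Definition _ (T : choiceType) (x0 : T) :=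
  isPointed.Build (pointed_at x0) x0.

Notation borel x0 :=
  (g_sigma_algebraType (open : set (set (pointed_at x0)))).

(* Integration against a finite signed measure, through its Jordan decomposition
   (which does not depend on the chosen Hahn decomposition). *)
Section charge_integral.
Context {d : measure_display} {T : measurableType d} {R : realType}.
Variable mu : {charge set T -> \bar R}.

Lemma ex_Hahn : exists PN : set T * set T, hahn_decomposition mu PN.1 PN.2.
Proof. by have [P [N PN]] := Hahn_decomposition mu; exists (P, N). Qed.

Definition Hahn_choice := projT2 (cid ex_Hahn).

Definition charge_integral (f : T -> R) : R :=
  Rintegral (jordan_pos Hahn_choice) setT f -
  Rintegral (jordan_neg Hahn_choice) setT f.
End charge_integral.

Section magnitude.
Context {R : realType} (T : metricType R).

Definition Zform (x0 : T) (mu nu : {charge set (borel x0) -> \bar R}) : R :=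
  charge_integral nu (fun y =>
    charge_integral mu (fun x => expR (- mdist (x : T) (y : T)))).

(* The magnitude of a (nonempty) compact positive definite metric space T; the
   base point x0 is only there to make the Borel sets a measurable type. *)
Definition magnitude : \bar R :=
  ereal_sup [set r | exists (x0 : T) (mu : {charge set (borel x0) -> \bar R}),
    Zform mu mu != 0 /\ r = (fine (mu setT) ^+ 2 / Zform mu mu)%:E].
End magnitude.

(* Main.v *)
Require Import Defs.
From HB Require Import structures.
From mathcomp Require Import all_boot all_order all_algebra.
From mathcomp Require Import all_classical all_reals all_analysis.
From mathcomp Require Import measurable_realfun.
From mathcomp Require Import ring lra.

(** The assertion is that W^2 <= C t^(n/beta) Z(mu, mu) for every charge mu of
    total mass W on A, with the kernel k(x - y) = exp (- t ||x - y||_p^beta): on A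
    the kernel dominates, in the sense of quadratic forms, a constant kernel of
    order t^(-n/beta).  The constant depends on A only through a bound for the
    differences of coordinates.

    The kernel is Lipschitz, so a charge can be concentrated on finitely many
    points without changing its mass and with a small change of Z
    ([Zform_discretisation]).  It remains to prove the inequality for finite
    weighted configurations ([lp_kernel_form]), with a constant that does not
    depend on the number of points.

    Consider first exp (- rho(x - y)) with rho(x) = sum_i |<x, th_i>|.  It is the
    probability that no hyperplane of a Poisson process separates x from y, where
    the hyperplanes orthogonal to th_i have intensity |th_i|.  For a fixed
    arrangement of hyperplanes with N cells, the kernel that is 1 when x and y
    lie in one cell and 0 otherwise has the quadratic form sum_c W_c^2 >= W^2 / N,
    where W_c is the weight of the cell c.  Taking expectations, the form of
    exp (- rho) is at least W^2 / E N.  Since m hyperplanes cut R^n into O(m^n)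
    cells, E N is at most (1 + s)^n, where s is the total measure of the
    hyperplanes that meet the configuration ([expectation_cells],
    [hyperplane_norm_form]); s is at most linear in the size of rho.

    The kernel k is a mixture of such kernels ([mixture_lp_kernel]).  The first
    ingredient is subordination: since (1 - z)^g is 1 minus a power series with
    nonnegative coefficients for 0 < g <= 1, all exp (- t psi^g) are mixtures if
    all exp (- s psi) are ([mixture_subordination]).  This settles p <= 1 by
    starting from the functions |x_j|.  For p > 1 it reduces the claim to
    exp (- t ||x||_p), and there ||x||_p is an average of functions |<x, th>|
    ([zonoid_lp_norm]): exp (- ||x||_p^p) is a limit of trigonometric polynomials
    sum_i c_i cos <x, th_i> with c_i >= 0, the integral of (1 - cos (u y)) / u^2
    over u > 0 is proportional to |y|, and that of
    (1 - exp (- u^p ||x||_p^p)) / u^2 to ||x||_p, both by scaling.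

    Finally, how large the functions rho in the mixture are can be read off from
    the kernel itself ([mixture_form]): k(e_l / M) >= 1 - t M^(-beta), so for M a
    large multiple of t^(1/beta) at least half of the mass of the mixture is
    carried by functions rho whose values at the unit vectors e_l are at most M,
    and these contribute W^2 / O(M^n). *)

Set Implicit Arguments.
Unset Strict Implicit.
Unset Printing Implicit Defensive.

Import Order.TTheory GRing.Theory Num.Theory.
Import numFieldNormedType.Exports.

Local Open Scope classical_set_scope.
Local Open Scope ring_scope.

(** * Cells of hyperplane arrangements *)

Section dot.
Context {R : realType} {n : nat}.
Implicit Types x y z : 'rV[R]_n.

Definition dot x y : R := \sum_(j < n) x ord0 j * y ord0 j.

Lemma dotDr z x y : dot z (x + y) = dot z x + dot z y.
Proof.
by rewrite /dot -big_split/=; apply: eq_bigr => j _; rewrite mxE mulrDr.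
Qed.

Lemma dotZr z c x : dot z (c *: x) = c * dot z x.
Proof.
by rewrite /dot mulr_sumr; apply: eq_bigr => j _; rewrite mxE mulrCA.
Qed.

Lemma dotBr z x y : dot z (x - y) = dot z x - dot z y.
Proof. by rewrite dotDr -scaleN1r dotZr mulN1r. Qed.

Lemma dotC x y : dot x y = dot y x.
Proof. by apply: eq_bigr => j _; rewrite mulrC. Qed.

Lemma dotDl z x y : dot (x + y) z = dot x z + dot y z.
Proof. by rewrite dotC dotDr !(dotC z). Qed.

Lemma dotZl z c x : dot (c *: x) z = c * dot x z.
Proof. by rewrite dotC dotZr dotC. Qed.

Lemma dot0r x : dot x 0 = 0.
Proof. by rewrite -(scale0r 0) dotZr mul0r. Qed.

Lemma dot0l x : dot 0 x = 0.
Proof. by rewrite dotC dot0r. Qed.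

Lemma dot_delta x c j : dot x (c *: delta_mx ord0 j) = c * x ord0 j.
Proof.
rewrite dotZr /dot (bigD1 j)//= big1 ?addr0.
  by rewrite mxE !eqxx mulr1.
by move=> i ij; rewrite mxE (negPf ij) andbF mulr0.
Qed.

End dot.

Section cells.
Context {R : realType}.

Section fixed_dimension.
Context {n : nat}.
Implicit Types (x y : 'rV[R]_n) (g h : 'rV[R]_n * R) (B : seq ('rV[R]_n * R)).

Definition affine g x : R := dot g.1 x + g.2.

Definition side g x : bool := 0 < affine g x.

Definition signature B x : seq bool := [seq side g x | g <- B].

Definition cells B (X : seq 'rV[R]_n) : nat :=
  size (undup [seq signature B x | x <- X]).

(** The point where the segment from x to y meets the hyperplane g = 0, when x
    and y lie on different sides of it. *)
Definition crossing g x y : 'rV[R]_n :=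
  (- affine g y / (affine g x - affine g y)) *: x +
  (affine g x / (affine g x - affine g y)) *: y.

Definition crossings g (X : seq 'rV[R]_n) : seq 'rV[R]_n :=
  [seq crossing g x y | x <- [seq x <- X | side g x],
                        y <- [seq y <- X | ~~ side g y]].

Lemma affine_crossing g h x y : side g x -> ~~ side g y ->
  affine h (crossing g x y) =
  - affine g y / (affine g x - affine g y) * affine h x +
  affine g x / (affine g x - affine g y) * affine h y.
Proof.
rewrite /side -leNgt => gx gy; rewrite /crossing.
set u := affine g x in gx *; set v := affine g y in gy *.
have d0 : u - v != 0 by rewrite gt_eqF// subr_gt0 (le_lt_trans gy).
rewrite /affine dotDr !dotZr.
by move: (dot h.1 x) (dot h.1 y) => s t; field.
Qed.

Lemma affine_crossing0 g x y : side g x -> ~~ side g y ->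
  affine g (crossing g x y) = 0.
Proof.
move=> gx gy; rewrite (affine_crossing _ gx gy).
move: gx gy; rewrite /side -leNgt => gx gy.
have d0 : affine g x - affine g y != 0.
  by rewrite gt_eqF// subr_gt0 (le_lt_trans gy).
by field.
Qed.

(** Half-spaces are convex, so every hyperplane that leaves x and y on one side
    leaves the whole segment there. *)
Lemma side_crossing g h x y : side g x -> ~~ side g y ->
  side h x = side h y -> side h (crossing g x y) = side h y.
Proof.
move=> gx gy; rewrite /side (affine_crossing _ gx gy).
move: gx gy; rewrite /side -leNgt => gx gy.
have d0 : 0 < affine g x - affine g y by rewrite subr_gt0 (le_lt_trans gy).
have l0 : 0 <= - affine g y / (affine g x - affine g y).
  by rewrite divr_ge0 ?oppr_ge0// ltW.
have m0 : 0 < affine g x / (affine g x - affine g y) by rewrite divr_gt0.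
have [hy|hy] := ltP 0 (affine h y) => hx.
  by apply: ltr_wpDl; [rewrite mulr_ge0// ltW | rewrite mulr_gt0].
apply/negbTE; rewrite -leNgt.
move/negbT: hx; rewrite -leNgt => hx.
by rewrite -oppr_ge0 opprD addr_ge0// -mulrN mulr_ge0// ?oppr_ge0// ltW.
Qed.

Lemma signature_crossing g B x y : side g x -> ~~ side g y ->
  signature B x = signature B y -> signature B (crossing g x y) = signature B y.
Proof.
move=> gx gy; elim: B => //= h B IH [hxy Bxy].
by rewrite IH// (side_crossing gx gy).
Qed.

(** A cell of B that is cut in two by g contains x and y on either side of g;
    the crossing point of the segment from x to y lies in the same cell and on
    g = 0.  Hence the cells gained by adding g are cells that B induces on the
    hyperplane g = 0, and this is what makes an induction on the dimension work.
    The set of crossing points is independent of B, so that the inequality can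
    be averaged over a random B. *)
Lemma cells_cons g B X :
  (cells (g :: B) X <= cells B X + cells B (crossings g X))%N.
Proof.
set U := undup [seq signature B x | x <- [seq x <- X | side g x]].
set V := undup [seq signature B x | x <- [seq x <- X | ~~ side g x]].
have gUV : (cells (g :: B) X <= size U + size V)%N.
  rewrite -(size_map (cons true) U) -(size_map (cons false) V) -size_cat.
  apply: uniq_leq_size; first exact: undup_uniq.
  move=> s; rewrite mem_undup => /mapP[x xX ->] /=; rewrite mem_cat.
  apply/orP; case: (boolP (side g x)) => gx; [left|right];
    by rewrite map_f// mem_undup map_f// mem_filter gx.
have VE : size V = (count (mem U) V + count (predC (mem U)) V)%N.
  by rewrite count_predC.
apply: leq_trans gUV _; rewrite VE addnA addnAC leq_add//.
  rewrite -size_filter -size_cat; apply: uniq_leq_size.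
    rewrite cat_uniq undup_uniq filter_uniq ?undup_uniq// andbT/=.
    by rewrite -all_predC; apply/allP => s; rewrite mem_filter => /andP[].
  move=> s; rewrite mem_cat mem_filter => /orP[|/andP[_]];
  rewrite /U /V !mem_undup => /mapP[x]; rewrite mem_filter => /andP[_ xX] ->;
  by rewrite map_f.
rewrite -size_filter; apply: uniq_leq_size.
  by rewrite filter_uniq ?undup_uniq.
move=> s; rewrite mem_filter/= /U /V !mem_undup => /andP[].
move=> /mapP[x]; rewrite mem_filter => /andP[gx xX] -> /mapP[y].
rewrite mem_filter => /andP[gy yX] Bxy; apply/mapP; exists (crossing g x y).
  by apply/allpairsP; exists (x, y) => /=; rewrite !mem_filter gx gy.
by rewrite (signature_crossing gx gy).
Qed.

Lemma cells_le1 B X : (forall x y, x \in X -> y \in X ->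
  signature B x = signature B y) -> (cells B X <= 1)%N.
Proof.
case: X => // x X xX; rewrite /cells -[leqRHS]/(size [:: signature B x]).
apply: uniq_leq_size; first exact: undup_uniq.
move=> s; rewrite mem_undup => /mapP[y yX ->]; rewrite inE; apply/eqP.
by apply: xX => //; rewrite mem_head.
Qed.

Definition same_cell B x y : R := (signature B x == signature B y)%:R.

(** The quadratic form is the sum of W_s^2 over the cells s, where W_s is the
    total weight of s, and W_s^2 >= 2 y W_s - y^2.  Keeping y free makes the
    lower bound affine in the number of cells, so that taking expectations
    replaces Jensen's inequality for 1 / (number of cells). *)
Lemma same_cell_form (I : finType) (w : I -> R) (x : I -> 'rV[R]_n) B (y : R) :
  2 * y * (\sum_i w i) - y ^+ 2 * (cells B [seq x i | i : I])%:R
  <= \sum_i \sum_j w i * w j * same_cell B (x i) (x j).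
Proof.
set S := undup [seq signature B z | z <- [seq x i | i : I]].
have inS i : signature B (x i) \in S.
  by rewrite mem_undup map_f// map_f// mem_enum.
pose W s := \sum_(i | signature B (x i) == s) w i.
have -> : \sum_i \sum_j w i * w j * same_cell B (x i) (x j) =
    \sum_(s <- S) W s ^+ 2.
  transitivity (\sum_i w i * W (signature B (x i))).
    apply: eq_bigr => i _; rewrite /W mulr_sumr [RHS]big_mkcond/=.
    apply: eq_bigr => j _; rewrite /same_cell eq_sym.
    by case: ifP => _; rewrite (mulr1, mulr0).
  transitivity (\sum_i \sum_(s <- S) (if signature B (x i) == s then w i * W s
    else 0)).
    apply: eq_bigr => i _; rewrite (bigD1_seq (signature B (x i)))//=; last first.
      exact: undup_uniq.
    rewrite eqxx big1 ?addr0// => s; rewrite eq_sym.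
    by case: ifP => //.
  rewrite exchange_big/=; apply: eq_bigr => s _.
  rewrite expr2 {2}/W mulr_suml [RHS]big_mkcond/=.
  by apply: eq_bigr => i _.
have -> : \sum_i w i = \sum_(s <- S) W s.
  rewrite /W; under [RHS]eq_bigr do rewrite big_mkcond/=.
  rewrite exchange_big/=; apply: eq_bigr => i _.
  rewrite (bigD1_seq (signature B (x i)))//=; last exact: undup_uniq.
  by rewrite eqxx big1 ?addr0// => s; rewrite eq_sym; case: ifP.
have -> : (cells B [seq x i | i : I])%:R = \sum_(s <- S) (1 : R).
  by rewrite big_const_seq count_predT /cells -/S iter_addr_0.
rewrite !mulr_sumr -sumrB; apply: ler_sum => s _.
by rewrite -subr_ge0; apply: le_trans (sqr_ge0 (W s - y)) _; lra.
Qed.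

End fixed_dimension.

Section expectation.
Context {T : Type}.
Implicit Types (F : seq (R * T)) (f : seq T -> R).

(** The expected value of f on the random sublist of F in which every g occurs
    independently, with the probability q that is paired with it. *)
Fixpoint expectation F f : R :=
  if F is (q, g) :: F' then
    (1 - q) * expectation F' f + q * expectation F' (f \o cons g)
  else f [::].

Lemma expectationD F f1 f2 : expectation F (fun B => f1 B + f2 B) =
  expectation F f1 + expectation F f2.
Proof.
elim: F f1 f2 => //= -[q g] F IH f1 f2.
by rewrite IH (IH (f1 \o cons g) (f2 \o cons g)); ring.
Qed.

Lemma expectationZ F c f :
  expectation F (fun B => c * f B) = c * expectation F f.
Proof.
elim: F f => //= -[q g] F IH f.
by rewrite IH (IH (f \o cons g)); ring.
Qed.

Lemma expectation_cst F c : expectation F (fun=> c) = c.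
Proof. by elim: F => //= -[q g] F IH; rewrite -[_ \o _]/(fun=> c) IH; ring. Qed.

Lemma expectation_sum (I : Type) (r : seq I) F (f : I -> seq T -> R) :
  expectation F (fun B => \sum_(i <- r) f i B) =
  \sum_(i <- r) expectation F (f i).
Proof.
elim: r => [|i r IH].
  rewrite big_nil -[RHS](expectation_cst F); congr expectation.
  by apply/funext => B; rewrite big_nil.
rewrite big_cons -IH -expectationD; congr expectation.
by apply/funext => B; rewrite big_cons.
Qed.

Definition probabilities F := all (fun qg => 0 <= qg.1 <= 1) F.

Lemma expectation_le F f1 f2 : probabilities F ->
  (forall B, f1 B <= f2 B) -> expectation F f1 <= expectation F f2.
Proof.
elim: F f1 f2 => [|[q g] F IH] f1 f2 /=; first by move=> _; exact.
move=> /andP[/andP[q0 q1] qF] f12; apply: lerD.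
  by rewrite ler_wpM2l ?subr_ge0// IH.
by rewrite ler_wpM2l// IH// => B; exact: f12.
Qed.

End expectation.

Lemma expectation_map (T U : Type) (h : T -> U) (F : seq (R * T)) f :
  expectation [seq (qg.1, h qg.2) | qg <- F] f = expectation F (f \o map h).
Proof. by elim: F f => //= -[q g] F IH f /=; rewrite !IH. Qed.

Lemma expectation_cells0 n (F : seq (R * ('rV[R]_n * R))) X :
  probabilities F -> (forall x y, x \in X -> y \in X -> x = y) ->
  expectation F (fun B => (cells B X)%:R) <= 1.
Proof.
move=> qF X1; rewrite -[leRHS](expectation_cst F); apply: expectation_le => // B.
by rewrite lern1; apply: cells_le1 => x y xX yX; rewrite (X1 x y).
Qed.

(** The affine function c on the hyperplane g = 0, written in the coordinates
    other than j; the j-th one is eliminated with the equation of the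
    hyperplane. *)
Definition restrict n (g : 'rV[R]_n.+1 * R) (j : 'I_n.+1) (c : 'rV[R]_n.+1 * R) :
    'rV[R]_n * R :=
  (\row_i (c.1 ord0 (lift j i) - c.1 ord0 j * g.1 ord0 (lift j i) / g.1 ord0 j),
   c.2 - c.1 ord0 j * g.2 / g.1 ord0 j).

Lemma affine_restrict n (g c : 'rV[R]_n.+1 * R) (j : 'I_n.+1) x :
  g.1 ord0 j != 0 -> affine g x = 0 ->
  affine (restrict g j c) (col' j x) = affine c x.
Proof.
move=> gj; rewrite /affine /dot !(@bigD1_ord _ _ _ _ j xpredT)//=.
have -> : \sum_(i < n) (restrict g j c).1 ord0 i * col' j x ord0 i =
  \sum_(i < n) c.1 ord0 (lift j i) * x ord0 (lift j i) -
  c.1 ord0 j / g.1 ord0 j *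
   \sum_(i < n) g.1 ord0 (lift j i) * x ord0 (lift j i).
  rewrite mulr_sumr -sumrB; apply: eq_bigr => i _; rewrite !mxE; ring.
set s := \sum_(i < n) g.1 _ _ * _; set t := \sum_(i < n) _.
rewrite /restrict/=; move: (x ord0 j) (c.1 ord0 j) (g.1 ord0 j) gj => u v w w0.
move=> g0; have -> : s = - g.2 - w * u by rewrite -[RHS]addr0 -g0; ring.
by field.
Qed.

(** N random hyperplanes cut R^n into O(N^n) cells.  By [cells_cons], adding a
    hyperplane that is present with probability q increases the expected number
    of cells by at most q times the expected number of cells in dimension
    n - 1, and (1 + s + q)^(n+1) - (1 + s)^(n+1) >= q (1 + s)^n. *)
Lemma expectation_cells n (F : seq (R * ('rV[R]_n * R))) X : probabilities F ->
  expectation F (fun B => (cells B X)%:R) <= (1 + \sum_(qg <- F) qg.1) ^+ n.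
Proof.
elim: n F X => [|n IHn] F X.
  by move=> qF; apply: expectation_cells0 => // x y _ _; apply/rowP => -[].
elim: F X => [|[q g] F IHF] X /=.
  by rewrite big_nil addr0 expr1n lern1 cells_le1.
move=> /andP[/andP[q0 q1] qF].
set Y := crossings g X.
have EY : expectation F (fun B => (cells B Y)%:R) <=
    (1 + \sum_(qg <- F) qg.1) ^+ n.
  (* A constant g separates no points, so there is nothing to restrict to. *)
have [g0|[j gj]] : g.1 = 0 \/ exists j, g.1 ord0 j != 0.
    have [[j gj]|g0] := pselect (exists j, g.1 ord0 j != 0); [right|left].
      by exists j.
    apply/rowP => j; rewrite mxE; apply/eqP; apply: contra_notT g0 => gj.
    by exists j.
  - have -> : Y = [::].
      have sg x : side g x = (0 < g.2) by rewrite /side /affine g0 dot0l add0r.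
      case YE : Y => [//|y Y'].
      have : y \in Y by rewrite YE mem_head.
      move=> /allpairsP[[u v] /=]; rewrite !mem_filter !sg.
      by move=> [/andP[-> _]].
    rewrite -[X in X <= _](_ : 0 = _); last first.
      by rewrite -[LHS](expectation_cst F).
    rewrite exprn_ge0// addr_ge0// big_seq sumr_ge0// => qg.
    by move/(allP qF) => /andP[].
  have -> : (fun B => (cells B Y)%:R : R) =
      (fun B => (cells B [seq col' j y | y <- Y])%:R) \o map (restrict g j).
    apply/funext => B /=; congr (_%:R); rewrite /cells -map_comp.
    congr (size (undup _)); apply/eq_in_map => y /allpairsP[[u v] /=].
    rewrite !mem_filter => -[/andP[gu _] /andP[gv _] yuv] /=.
    rewrite /signature -map_comp; apply: eq_map => c /=.
    by rewrite /side affine_restrict// yuv affine_crossing0.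
  rewrite -expectation_map.
  apply: le_trans (IHn _ _ _) _; first by rewrite /probabilities all_map.
  by rewrite big_map.
have EgX : expectation F ((fun B => (cells B X)%:R) \o cons g) <=
    expectation F (fun B => (cells B X)%:R) + expectation F (fun B =>
      (cells B Y)%:R).
  rewrite -expectationD; apply: expectation_le => // B /=.
  by rewrite -natrD ler_nat cells_cons.
rewrite big_cons/=; set s := \sum_(qg <- F) qg.1 in EY IHF *.
have s0 : 0 <= s.
  by rewrite /s big_seq sumr_ge0// => qg; move/(allP qF) => /andP[].
set E := expectation F (fun B => (cells B X)%:R) in EgX *.
set G := expectation _ _ in EgX *; set H := expectation _ _ in EY EgX.
apply: (@le_trans _ _ ((1 + s) ^+ n * (1 + s + q))).
  have := IHF X qF; rewrite -/E exprSr => EX.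
  have : q * G <= q * (E + H) by rewrite ler_wpM2l.
  have : q * H <= q * (1 + s) ^+ n by rewrite ler_wpM2l.
  by lra.
rewrite [in leRHS]exprSr [q + s]addrC addrA ler_wpM2r//.
  by rewrite !addr_ge0.
by apply: lerXn2r; rewrite ?nnegrE ?addr_ge0// lerDl.
Qed.

End cells.

(** * The kernel of a random hyperplane arrangement *)

Section cut_kernels.
Context {R : realType} {n : nat}.
Implicit Types (F : seq (R * ('rV[R]_n * R))) (th x y : 'rV[R]_n).

(** The probability that no hyperplane of the random arrangement F separates x
    from y. *)
Definition not_separated F x y : R :=
  \prod_(qg <- F) (1 - qg.1 * (side qg.2 x != side qg.2 y)%:R).

Lemma expectation_same_cell F x y :
  expectation F (fun B => same_cell B x y) = not_separated F x y.
Proof.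
rewrite /not_separated; elim: F => [|[q g] F IH] /=.
  by rewrite big_nil /same_cell eqxx.
rewrite big_cons /= -{}IH.
have -> : (fun B => same_cell B x y) \o cons g =
    (fun B => (side g x == side g y)%:R * same_cell B x y).
  by apply/funext => B /=; rewrite /same_cell/= eqseq_cons -natrM mulnb.
by rewrite expectationZ; case: (side g x == side g y) => /=; ring.
Qed.

(** For an arrangement with N cells, W^2 is at most N times the sum of the squared
    weights of the cells; this is averaged in the affine form of
    [same_cell_form], with y = W / (1 + s)^n. *)
Lemma not_separated_form (I : finType) (w : I -> R) (x : I -> 'rV[R]_n) F :
  probabilities F ->
  (\sum_i w i) ^+ 2 / (1 + \sum_(qg <- F) qg.1) ^+ n <=
  \sum_i \sum_j w i * w j * not_separated F (x i) (x j).
Proof.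
move=> qF; set W := \sum_i w i; set E := _ ^+ n.
have s0 : 0 <= \sum_(qg <- F) qg.1.
  by rewrite big_seq sumr_ge0// => qg; move/(allP qF) => /andP[].
have E0 : 0 < E by rewrite exprn_gt0// ltr_pwDl.
have -> : \sum_i \sum_j w i * w j * not_separated F (x i) (x j) =
    expectation F (fun B => \sum_i \sum_j w i * w j * same_cell B (x i) (x j)).
  rewrite expectation_sum; apply: eq_bigr => i _.
  rewrite expectation_sum; apply: eq_bigr => j _.
  by rewrite expectationZ expectation_same_cell.
have := expectation_le qF
  (fun B => same_cell_form w x B (W / E)).
apply: le_trans.
rewrite (_ : (fun B => _) = (fun B => 2 * (W / E) * W +
   - (W / E) ^+ 2 * (cells B [seq x i | i : I])%:R)); last first.
  by apply/funext => B; rewrite mulNr.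
rewrite expectationD expectation_cst expectationZ.
have := expectation_cells [seq x i | i : I] qF; rewrite -/E.
set C := expectation _ _ => CE.
have : (W / E) ^+ 2 * C <= (W / E) ^+ 2 * E by rewrite ler_wpM2l// sqr_ge0.
have -> : (W / E) ^+ 2 * E = W ^+ 2 / E.
  by field; rewrite gt_eqF.
have -> : 2 * (W / E) * W = 2 * (W ^+ 2 / E) by field; rewrite gt_eqF.
by rewrite mulNr; move: (W ^+ 2 / E) (_ * C) => a b; lra.
Qed.

(** For consecutive values u <= v of dot th on a finite configuration, a single
    hyperplane, drawn with probability 1 - exp (u - v), stands for the part
    between u and v of a Poisson process of hyperplanes orthogonal to th: on that
    configuration all of these separate the same points. *)
Fixpoint cuts th (u : R) (s : seq R) : seq (R * ('rV[R]_n * R)) :=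
  if s is v :: s' then (1 - expR (u - v), (th, - u)) :: cuts th v s' else [::].

Lemma side_cut th u x : side (th, - u) x = (u < dot th x).
Proof. by rewrite /side /affine subr_gt0. Qed.

Lemma cuts_probabilities th u s : path <=%R u s -> probabilities (cuts th u s).
Proof.
elim: s u => //= v s IH u /andP[uv vs]; rewrite IH// andbT.
by rewrite subr_ge0 gerBl expR_ge0 -expR0 ler_expR subr_le0 uv.
Qed.

Lemma cuts_total th u s : path <=%R u s ->
  \sum_(qg <- cuts th u s) qg.1 <= last u s - u.
Proof.
elim: s u => [|v s IH] u /=; first by rewrite big_nil subrr.
move=> /andP[uv vs]; rewrite big_cons/=.
have := IH v vs; have := expR_ge1Dx (u - v); lra.
Qed.

Lemma cuts_below th u s x y : path <=%R u s ->
  dot th x <= u -> dot th y <= u -> not_separated (cuts th u s) x y = 1.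
Proof.
elim: s u => [|v s IH] u /=; first by rewrite /not_separated big_nil.
move=> /andP[uv vs] xu yu; rewrite /not_separated big_cons -/(not_separated _ _
  _).
rewrite IH//; try exact: le_trans uv.
by rewrite /= !side_cut !ltNge xu yu/= mulr0 subr0 mul1r.
Qed.

Lemma cuts_cons th u v s x y :
  not_separated (cuts th u (v :: s)) x y =
  (1 - (1 - expR (u - v)) * ((u < dot th x) != (u < dot th y))%:R) *
  not_separated (cuts th v s) x y.
Proof. by rewrite /not_separated/= big_cons/= !side_cut. Qed.

Lemma path_ge u (s : seq R) z : path <=%R u s -> z \in u :: s -> u <= z.
Proof.
move=> us; rewrite in_cons => /predU1P[->//|].
by move/allP: (order_path_min le_trans us); exact.
Qed.

(** The factors exp (u - v) of the hyperplanes below y telescope. *)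
Lemma cuts_exp_below th u s x y : path <=%R u s ->
  dot th x <= u -> dot th y \in u :: s ->
  not_separated (cuts th u s) x y = expR (u - dot th y).
Proof.
elim: s u => [|v s IH] u us xu; rewrite in_cons => /predU1P[yu|//].
- by rewrite cuts_below ?yu// subrr expR0.
- by rewrite cuts_below ?yu// subrr expR0.
move=> ys; have [uv vs] := andP us; have vy := path_ge vs ys.
rewrite cuts_cons IH// ?(le_trans xu)// [u < dot th x]ltNge xu/=.
have [uy|yu] := ltP u (dot th y).
  by rewrite mulr1 subKr -expRD addrA subrK.
have -> : v = u by apply/eqP; rewrite eq_le uv (le_trans vy yu).
by rewrite mulr0 subr0 mul1r.
Qed.

Lemma cuts_exp th u s x y : path <=%R u s ->
  dot th x \in u :: s -> dot th y \in u :: s -> dot th x <= dot th y ->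
  not_separated (cuts th u s) x y = expR (dot th x - dot th y).
Proof.
have at_u w t : path <=%R w t -> dot th x = w -> dot th y \in w :: t ->
    not_separated (cuts th w t) x y = expR (dot th x - dot th y).
  by move=> wt xw yt; rewrite cuts_exp_below ?xw.
elim: s u => [|v s IH] u us; rewrite in_cons => /predU1P[xu|//].
- by move=> yu _; exact: at_u.
- by move=> yu _; exact: at_u.
move=> xs; have [uv vs] := andP us; have vx := path_ge vs xs.
rewrite in_cons => /predU1P[yu xy|ys xy].
  have xu : dot th x = u.
    by apply/eqP; rewrite eq_le -{1}yu xy (le_trans uv).
  by apply: at_u => //; rewrite yu mem_head.
rewrite cuts_cons IH//.
have [ux|xu] := ltP u (dot th x).
  by rewrite (lt_le_trans ux xy) mulr0 subr0 mul1r.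
have -> : v = u by apply/eqP; rewrite eq_le uv (le_trans vx xu).
by rewrite subrr expR0 subrr mul0r subr0 mul1r.
Qed.

Lemma exp_dot_cuts (I : finType) (i0 : I) (x : I -> 'rV[R]_n) (L : R) th :
  (forall i j k, `|x i ord0 k - x j ord0 k| <= L) ->
  exists F, [/\ probabilities F, \sum_(qg <- F) qg.1 <= L * \sum_j `|th ord0 j| &
    forall i j, not_separated F (x i) (x j) = expR (- `|dot th (x i - x j)|)].
Proof.
move=> xL; set V := sort <=%R [seq dot th (x i) | i : I].
have Vmem i : dot th (x i) \in V by rewrite mem_sort;
  exact: (codom_f (fun i => dot th (x i))).
have Vsort : sorted <=%R V by apply: sort_sorted; exact: le_total.
have Vim v : v \in V -> exists i, v = dot th (x i).
  by rewrite mem_sort => /mapP[i _ ->]; exists i.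
have dotL i j : `|dot th (x i) - dot th (x j)| <= L * \sum_j `|th ord0 j|.
  rewrite -dotBr /dot mulr_sumr; apply: le_trans (ler_norm_sum _ _ _) _.
  apply: ler_sum => k _; rewrite normrM mulrC ler_wpM2r//.
  by rewrite !mxE xL.
case: V Vmem Vsort Vim => [/(_ i0)//|u s] Vmem us Vim.
exists (cuts th u s); split.
- exact: cuts_probabilities.
- apply: le_trans (cuts_total _ us) _.
  have [i ui] := Vim _ (mem_head u s).
  have [j lj] := Vim _ (mem_last u s).
  by rewrite lj [X in _ - X]ui (le_trans (ler_norm _)).
move=> i j; rewrite dotBr.
have [ij|/ltW ji] := leP (dot th (x i)) (dot th (x j)).
  by rewrite cuts_exp// ler0_norm ?subr_le0// opprK.
rewrite ger0_norm ?subr_ge0// opprB -(cuts_exp us (Vmem j) (Vmem i) ji).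
by apply: eq_bigr => qg _; rewrite eq_sym.
Qed.

(** The support function of a zonotope; its value at x - y is the measure of the
    hyperplanes that separate x from y. *)
Definition hyperplane_norm (s : seq 'rV[R]_n) x : R := \sum_(th <- s) `|dot th x|.

(** Independent arrangements are superposed by concatenation, which multiplies
    the probabilities of not being separated. *)
Lemma hyperplane_norm_cuts (I : finType) (i0 : I) (x : I -> 'rV[R]_n) (L : R) s :
  (forall i j k, `|x i ord0 k - x j ord0 k| <= L) ->
  exists F, [/\ probabilities F,
    \sum_(qg <- F) qg.1 <= L * \sum_j hyperplane_norm s (delta_mx ord0 j) &
    forall i j, not_separated F (x i) (x j) =
      expR (- hyperplane_norm s (x i - x j))].
Proof.
move=> xL; elim: s => [|th s [F [F1 F2 F3]]].
  exists [::]; split => // [|i j].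
    by rewrite big_nil big1 ?mulr0// => j _; rewrite /hyperplane_norm big_nil.
  by rewrite /not_separated /hyperplane_norm !big_nil oppr0 expR0.
have [G [G1 G2 G3]] := exp_dot_cuts i0 th xL.
exists (G ++ F); split.
- by rewrite /probabilities all_cat; apply/andP.
- rewrite big_cat/= (le_trans (lerD G2 F2))// -mulrDr -big_split/=.
  rewrite le_eqVlt; apply/orP; left; apply/eqP; congr (_ * _).
  apply: eq_bigr => j _; rewrite /hyperplane_norm big_cons; congr (_ + _).
  by rewrite -[delta_mx _ _]scale1r dot_delta mul1r.
move=> i j; rewrite /not_separated big_cat/= -!/(not_separated _ _ _) F3 G3.
by rewrite /hyperplane_norm big_cons opprD expRD.
Qed.

(** The bound involves only the expected number of hyperplanes that meet the
    configuration, which is at most L times the size of rho; this is why it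
    decreases polynomially and not exponentially in rho. *)
Lemma hyperplane_norm_form (I : finType) (w : I -> R) (x : I -> 'rV[R]_n)
    (L : R) s :
  (forall i j k, `|x i ord0 k - x j ord0 k| <= L) ->
  (\sum_i w i) ^+ 2 / (1 + L * \sum_j hyperplane_norm s (delta_mx ord0 j)) ^+ n <=
  \sum_i \sum_j w i * w j * expR (- hyperplane_norm s (x i - x j)).
Proof.
move=> xL; have [i0 _|I0] := pickP I; last first.
  by rewrite [X in X ^+ 2]big1 ?[leRHS]big1 ?expr0n ?mul0r// => i; have := I0 i.
have [F [qF F2 F3]] := hyperplane_norm_cuts i0 s xL.
have s0 : 0 <= \sum_(qg <- F) qg.1.
  by rewrite big_seq sumr_ge0// => qg; move/(allP qF) => /andP[].
apply: le_trans _ (le_trans (not_separated_form w x qF) _).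
  rewrite ler_wpM2l ?sqr_ge0// lef_pV2 ?posrE ?exprn_gt0 ?ltr_pwDl//.
    by apply: lerXn2r; rewrite ?nnegrE ?addr_ge0// ?(le_trans s0)// lerD2l.
  exact: le_trans F2.
by apply: ler_sum => i _; apply: ler_sum => j _; rewrite F3.
Qed.

End cut_kernels.

(** * Mixtures of hyperplane kernels *)

Lemma cvg_sumr (R : realType) (I : Type) (r : seq I) (u : nat -> I -> R)
    (l : I -> R) : (forall i, u m i @[m --> \oo] --> l i) ->
  \sum_(i <- r) u m i @[m --> \oo] --> \sum_(i <- r) l i.
Proof.
move=> ul; elim: r => [|i r IH].
  by under eq_fun do rewrite big_nil; rewrite big_nil; exact: cvg_cst.
by under eq_fun do rewrite big_cons; rewrite big_cons; exact: cvgD.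
Qed.

Section mixture.
Context {R : realType} {n : nat}.
Implicit Types (k : 'rV[R]_n -> R) (x : 'rV[R]_n).

(** The closed convex cone generated by the kernels exp (- rho).  It is defined by
    its generation rules and not by mixing measures: a statement about a kernel
    that is linear in the kernel and passes to pointwise limits has to be checked
    on the generators only. *)
Inductive mixture : ('rV[R]_n -> R) -> Prop :=
| mixture_atom s : mixture (fun x => expR (- hyperplane_norm s x))
| mixtureZ c k : 0 <= c -> mixture k -> mixture (fun x => c * k x)
| mixtureD k1 k2 : mixture k1 -> mixture k2 -> mixture (fun x => k1 x + k2 x)
| mixture_lim (k_ : nat -> 'rV[R]_n -> R) k : (forall m, mixture (k_ m)) ->
    (forall x, k_ m x @[m --> \oo] --> k x) -> mixture k.

Lemma mixture_ext k1 k2 : k1 =1 k2 -> mixture k1 -> mixture k2.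
Proof. by move=> /funext ->. Qed.

Lemma mixture_cst c : 0 <= c -> mixture (fun=> c).
Proof.
move=> c0; apply: mixture_ext (mixtureZ c0 (mixture_atom [::])) => x.
by rewrite /hyperplane_norm big_nil oppr0 expR0 mulr1.
Qed.

Lemma mixtureM k1 k2 : mixture k1 -> mixture k2 ->
  mixture (fun x => k1 x * k2 x).
Proof.
move=> + mk2; elim=> {k1} [s|c k c0 _ IH|k k' _ IH _ IH'|k_ k _ IH kk].
- elim: mk2 => {k2} [s'|c k c0 _ IH|k k' _ IH _ IH'|k_ k _ IH kk].
  + apply: mixture_ext (mixture_atom (s ++ s')) => x.
    by rewrite /hyperplane_norm big_cat/= opprD expRD.
  + by apply: mixture_ext (mixtureZ c0 IH) => x; ring.
  + by apply: mixture_ext (mixtureD IH IH') => x; ring.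
  + by apply: (mixture_lim IH) => x; apply: cvgMl_tmp; exact: kk.
- by apply: mixture_ext (mixtureZ c0 IH) => x; ring.
- by apply: mixture_ext (mixtureD IH IH') => x; ring.
- by apply: (mixture_lim IH) => x; apply: cvgMr_tmp; exact: kk.
Qed.

Lemma mixtureX k m : mixture k -> mixture (fun x => k x ^+ m).
Proof.
move=> mk; elim: m => [|m IH]; first exact: mixture_cst.
by apply: mixture_ext (mixtureM mk IH) => x; rewrite exprS.
Qed.

Lemma mixture_sum (I : Type) (r : seq I) (k : I -> 'rV[R]_n -> R) :
  (forall i, mixture (k i)) -> mixture (fun x => \sum_(i <- r) k i x).
Proof.
move=> mk; elim: r => [|i r IH].
  by apply: mixture_ext (mixture_cst (lexx 0)) => x; rewrite big_nil.
by apply: mixture_ext (mixtureD (mk i) IH) => x; rewrite big_cons.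
Qed.

Lemma mixture_prod (I : Type) (r : seq I) (k : I -> 'rV[R]_n -> R) :
  (forall i, mixture (k i)) -> mixture (fun x => \prod_(i <- r) k i x).
Proof.
move=> mk; elim: r => [|i r IH].
  by apply: mixture_ext (mixture_cst ler01) => x; rewrite big_nil.
by apply: mixture_ext (mixtureM (mk i) IH) => x; rewrite big_cons.
Qed.

Lemma mixture_exp k : mixture k -> mixture (fun x => expR (k x)).
Proof.
move=> mk; apply: (@mixture_lim (fun m x => \sum_(0 <=
  i < m) (i`!%:R^-1 * k x ^+ i))).
  move=> m; apply: mixture_sum => i; apply: mixtureZ; last exact: mixtureX.
  by rewrite invr_ge0.
move=> x; have := is_cvg_series_exp_coeff (k x).
rewrite /expR => /cvg_ex[l cl]; rewrite (cvg_lim _ cl)//.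
apply: cvg_trans cl; apply: near_eq_cvg; apply: nearW => m /=.
by rewrite /series/=; apply: eq_bigr => i _; rewrite /exp_coeff/= mulrC.
Qed.

Lemma hyperplane_normZ s c x : hyperplane_norm s (c *: x) =
  `|c| * hyperplane_norm s x.
Proof.
by rewrite /hyperplane_norm mulr_sumr; apply: eq_bigr => th _;
  rewrite dotZr normrM.
Qed.

Lemma hyperplane_norm_ge0 s x : 0 <= hyperplane_norm s x.
Proof. by rewrite sumr_ge0. Qed.

Definition form (I : finType) (w : I -> R) (x : I -> 'rV[R]_n) k : R :=
  \sum_i \sum_j w i * w j * k (x i - x j).

(** For a mixture k of kernels exp (- rho), k 0 - k (e_l / M) is at least half the
    mass of the rho with rho (e_l) > M.  Therefore the last factor
    on the left is at most the mass of the rho that are bounded by M on all basis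
    vectors e_l, and for these [hyperplane_norm_form] applies.  Stated as a linear
    inequality in k, it is stable under the rules that define [mixture]. *)
Lemma mixture_form (I : finType) (w : I -> R) (x : I -> 'rV[R]_n) (L M : R) k :
  (forall i j l, `|x i ord0 l - x j ord0 l| <= L) -> 0 <= L -> 0 < M ->
  mixture k ->
  (\sum_i w i) ^+ 2 / (1 + L * (n%:R * M)) ^+ n *
    (k 0 - 2 * \sum_(l < n) (k 0 - k (M^-1 *: delta_mx ord0 l))) <=
  form w x k.
Proof.
move=> xL L0 M0; set W := _ / _.
have W0 : 0 <= W.
  by rewrite divr_ge0 ?sqr_ge0// exprn_ge0// addr_ge0// !mulr_ge0// ltW.
elim=> {k} [s|c k c0 _ IH|k k' _ IH _ IH'|k_ k _ IH kk].
- have := hyperplane_norm_form w s xL; rewrite -/(form w x _) => H.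
  have k0 : hyperplane_norm s 0 = 0 by rewrite -(scale0r 0) hyperplane_normZ
    normr0 mul0r.
  rewrite k0 oppr0 expR0.
  have term l : 0 <= 1 - expR (- hyperplane_norm s (M^-1 *: delta_mx ord0 l)).
    by rewrite subr_ge0 -expR0 ler_expR oppr_le0 hyperplane_norm_ge0.
  have den0 y : 0 <= y -> 0 < (1 + L * y) ^+ n.
    by move=> y0; rewrite exprn_gt0// ltr_pwDl// mulr_ge0.
  have sum0 : 0 <= \sum_j hyperplane_norm s (delta_mx ord0 j).
    by rewrite sumr_ge0// => j _; exact: hyperplane_norm_ge0.
  have [sM|] := pselect (forall l, hyperplane_norm s (delta_mx ord0 l) <= M).
    apply: le_trans H; apply: (@le_trans _ _ W).
      rewrite -[leRHS]mulr1 ler_wpM2l// gerBl mulr_ge0// sumr_ge0//.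
    have nM0 : 0 <= n%:R * M by rewrite mulr_ge0// ltW.
    rewrite ler_wpM2l ?sqr_ge0// lef_pV2 ?posrE ?den0//.
    apply: lerXn2r; rewrite ?nnegrE ?addr_ge0 ?(mulr_ge0 L0)//.
    rewrite lerD2l ler_wpM2l//.
    apply: (le_trans (ler_sum _ (fun j _ => sM j))).
    by rewrite sumr_const card_ord mulr_natl.
  move=> /existsNP[l /negP]; rewrite -ltNge => lM.
  apply: (@le_trans _ _ 0); last first.
    by apply: le_trans H; rewrite divr_ge0 ?sqr_ge0// ltW// den0.
  rewrite mulr_ge0_le0// subr_le0 (bigD1 l)//=.
  have h1 : 1 < hyperplane_norm s (M^-1 *: delta_mx ord0 l).
    by rewrite hyperplane_normZ ger0_norm ?invr_ge0 ?ltW// mulrC ltr_pdivlMr//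
      mul1r.
  have e1 : expR (- hyperplane_norm s (M^-1 *: delta_mx ord0 l)) <= 2^-1.
    rewrite expRN lef_pV2 ?posrE ?expR_gt0//.
    by apply: le_trans (expR_ge1Dx _); lra.
  have : 0 <= \sum_(i < n | i != l)
      (1 - expR (- hyperplane_norm s (M^-1 *: delta_mx ord0 i))).
    by rewrite sumr_ge0.
  by lra.
- have -> : form w x (fun x => c * k x) = c * form w x k.
    rewrite /form mulr_sumr; apply: eq_bigr => i _; rewrite mulr_sumr.
    by apply: eq_bigr => j _; ring.
  apply: le_trans (ler_wpM2l c0 IH); rewrite le_eqVlt; apply/orP; left; apply/eqP.
  under eq_bigr do rewrite -mulrBr.
  by rewrite -mulr_sumr; ring.
- have -> : form w x (fun x => k x + k' x) = form w x k + form w x k'.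
    rewrite /form -big_split/=; apply: eq_bigr => i _; rewrite -big_split/=.
    by apply: eq_bigr => j _; ring.
  apply: le_trans (lerD IH IH'); rewrite le_eqVlt; apply/orP; left; apply/eqP.
  under eq_bigr do rewrite opprD addrACA.
  by rewrite big_split/=; ring.
pose bound k := W * (k 0 - 2 * \sum_(l < n) (k 0 - k (M^-1 *: delta_mx ord0 l))).
have bound_cvg : bound (k_ m) @[m --> \oo] --> bound k.
  apply: cvgMl_tmp; apply: cvgB; first exact: kk.
  by apply: cvgMl_tmp; apply: cvg_sumr => l; apply: cvgB; exact: kk.
have form_cvg : form w x (k_ m) @[m --> \oo] --> form w x k.
  rewrite /form; apply: cvg_sumr => i; apply: cvg_sumr => j.
  by apply: cvgMl_tmp; exact: kk.
by apply: ler_cvg_to bound_cvg form_cvg _; exact: nearW.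
Qed.

End mixture.

(** * The binomial series of (1 - z)^g *)

Section binomial_series.
Context {R : realType} (g : R) (g_gt0 : 0 < g) (g_le1 : g <= 1).
Implicit Types (z : R) (m K : nat).

(** The coefficients a_m of z^(m+1) in 1 - (1 - z)^g; they are nonnegative since
    0 < g <= 1. *)
Fixpoint binomial_coef m : R :=
  if m is m'.+1 then binomial_coef m' * (m'.+1%:R - g) / m'.+2%:R else g.

Lemma binomial_coef_ge0 m : 0 <= binomial_coef m.
Proof.
elim: m => [|m IH] /=; first exact: ltW.
by rewrite divr_ge0// mulr_ge0// subr_ge0 (le_trans g_le1)// ler1n.
Qed.

Definition binomial_sum K z : R := \sum_(m < K) binomial_coef m * z ^+ m.+1.

Lemma binomial_sumS K z :
  binomial_sum K.+1 z = binomial_sum K z + binomial_coef K * z ^+ K.+1.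
Proof. by rewrite /binomial_sum big_ord_recr. Qed.

Definition dbinomial_sum K z : R :=
  \sum_(m < K) m.+1%:R * binomial_coef m * z ^+ m.

Lemma dbinomial_sumS K z : dbinomial_sum K.+1 z =
  dbinomial_sum K z + K.+1%:R * binomial_coef K * z ^+ K.
Proof. by rewrite /dbinomial_sum big_ord_recr. Qed.

Lemma is_derive_binomial_sum K z :
  is_derive z 1 (binomial_sum K) (dbinomial_sum K z).
Proof.
elim: K => [|K IH].
  rewrite (_ : binomial_sum 0 = cst 0); last first.
    by apply/funext => x; rewrite /binomial_sum big_ord0.
  by rewrite /dbinomial_sum big_ord0; exact: is_derive_cst.
rewrite (_ : binomial_sum K.+1 =
  binomial_sum K \+ (fun z => binomial_coef K * z ^+ K.+1)); last first.
  by apply/funext => x; rewrite binomial_sumS.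
rewrite dbinomial_sumS; apply: is_deriveD.
rewrite [X in is_derive _ _ _ X](_ : _ =
  binomial_coef K *: (K.+1%:R * z ^+ K)); last by rewrite -[RHS]/(_ * _); ring.
apply: is_deriveZ; apply: DeriveDef; first exact: exprn_derivable.
by rewrite exp_derive scaler1.
Qed.

(** The partial sums P satisfy the equation (1 - z) P' = g (1 - P) of
    1 - (1 - z)^g up to a multiple of z^K. *)
Lemma binomial_sum_ode K z :
  g * (1 - binomial_sum K z) - (1 - z) * dbinomial_sum K z =
  K.+1%:R * binomial_coef K * z ^+ K.
Proof.
elim: K => [|K IH].
  by rewrite /binomial_sum /dbinomial_sum !big_ord0/=; ring.
rewrite binomial_sumS dbinomial_sumS.
have -> : K.+2%:R * binomial_coef K.+1 = binomial_coef K * (K.+1%:R - g).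
  by rewrite /= mulrC divfK.
rewrite exprS; move: (binomial_sum K z) (dbinomial_sum K z) IH => P D IH.
transitivity (g * (1 - P) - (1 - z) * D - g * (binomial_coef K * (z * z ^+ K)) -
  (1 - z) * (K.+1%:R * binomial_coef K * z ^+ K)); first by ring.
by rewrite IH; ring.
Qed.

Lemma binomial_sum_ge0 K z : 0 <= z -> 0 <= binomial_sum K z.
Proof.
by move=> z0; rewrite sumr_ge0// => m _; rewrite mulr_ge0 ?exprn_ge0//
  binomial_coef_ge0.
Qed.

Lemma binomial_sum_le K z : 0 <= z -> z <= 1 -> binomial_sum K z <=
  binomial_sum K 1.
Proof.
move=> z0 z1; apply: ler_sum => m _; rewrite ler_wpM2l ?binomial_coef_ge0//.
by rewrite expr1n exprn_ile1.
Qed.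

Lemma binomial_coef_le1 K : K.+1%:R * binomial_coef K <= 1.
Proof.
elim: K => [|K IH]; first by rewrite mul1r.
rewrite /= mulrC divfK//; apply: le_trans IH.
by rewrite mulrC ler_wpM2r ?binomial_coef_ge0// gerBl ltW.
Qed.

Lemma binomial_sum1 K : binomial_sum K 1 <= 1.
Proof.
have := binomial_sum_ode K 1; rewrite subrr mul0r subr0 expr1n mulr1 => H.
have : 0 <= g * (1 - binomial_sum K 1) by rewrite H mulr_ge0// binomial_coef_ge0.
by rewrite pmulr_rge0// subr_ge0.
Qed.

(** By [binomial_sum_ode] the quotient of 1 - P by (1 - z)^g, which is 1 at 0, has
    the derivative (K+1) a_K z^K (1 - z)^(-g-1); the mean value theorem bounds it
    on both sides. *)
Lemma binomial_sum_bounds K z : 0 < z -> z < 1 ->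
  (1 - z) `^ g <= 1 - binomial_sum K z <= (1 - z) `^ g + (1 - z)^-1 * z ^+ K.
Proof.
move=> z0 z1.
pose h x := (1 - binomial_sum K x) * (1 - x) `^ (- g).
pose dh x := K.+1%:R * binomial_coef K * x ^+ K * (1 - x) `^ (- g - 1).
have h_derive (x : R) : x < 1 -> is_derive x 1 h (dh x).
  move=> x1; have x10 : 0 < 1 - x by rewrite subr_gt0.
  have d1 : is_derive x 1 (fun y : R => 1 - y) (-1).
    by rewrite -[-1]add0r; apply: is_deriveB.
  have d2 : is_derive x 1 (fun y => (1 - y) `^ (- g))
      (- g * (1 - x) `^ (- g - 1) * -1).
    exact: (@is_derive1_comp _ (fun y => y `^ (- g)) (fun y => 1 - y) _ _ _
      (is_derive1_powR _ x10) d1).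
  have d3 : is_derive x 1 (fun y => 1 - binomial_sum K y) (- dbinomial_sum K x).
    rewrite -[- _]add0r; apply: is_deriveB; exact: is_derive_binomial_sum.
  apply: (is_derive_eq (is_deriveM d3 d2)).
  rewrite -![_ *: _]/(_ * _) /dh -binomial_sum_ode.
  rewrite (_ : (1 - x) `^ (- g) = (1 - x) * (1 - x) `^ (- g - 1)); last first.
    have -> : - g = 1 + (- g - 1) by ring.
    rewrite powRD ?(gt_eqF x10) ?implybT// powRr1 ?ltW//.
    by congr (_ * _ `^ _); ring.
  by move: (_ `^ _) => w; ring.
have h0 : h 0 = 1.
  rewrite /h subr0 powR1 mulr1 /binomial_sum big1 ?subr0// => m _.
  by rewrite expr0n mulr0.
have cont : {within `[0, z], continuous h}.
  apply: derivable_within_continuous => x; rewrite in_itv/= => /andP[_ xz].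
  by apply: ex_derive; apply: h_derive; exact: le_lt_trans z1.
have hd x : x \in `]0, z[ -> is_derive x 1 h (dh x).
  by rewrite in_itv/= => /andP[_ xz]; apply: h_derive; exact: lt_trans z1.
have [c] := MVT z0 hd cont.
rewrite in_itv/= => /andP[c0 cz]; rewrite h0 subr0 => /eqP;
  rewrite subr_eq => /eqP hz.
have c1 : 0 < 1 - c by rewrite subr_gt0 (lt_trans cz).
have z10 : 0 < 1 - z by rewrite subr_gt0.
have hE : 1 - binomial_sum K z = (1 - z) `^ g * h z.
  by rewrite /h mulrCA powRN divff ?mulr1// gt_eqF// powR_gt0.
have b0 : 0 <= K.+1%:R * binomial_coef K by rewrite mulr_ge0// binomial_coef_ge0.
have dh0 : 0 <= dh c * z.
  by rewrite mulr_ge0 ?(ltW z0)// mulr_ge0 ?powR_ge0// mulr_ge0// exprn_ge0// ltW.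
rewrite hE hz mulrDr mulr1 [_ * (_ * z) + _]addrC lerDl lerD2l.
rewrite mulr_ge0 ?powR_ge0//=.
have -> : (1 - z) `^ g * (dh c * z) =
    (((1 - z) `^ g / (1 - c) `^ g) * (1 - c)^-1) *
    ((K.+1%:R * binomial_coef K) * (c ^+ K * z)).
  rewrite /dh powRD ?(gt_eqF c1) ?implybT// !powRN powRr1 ?(ltW c1)//.
  by move: (_^-1) => v; ring.
apply: ler_pM.
- by rewrite mulr_ge0 ?divr_ge0 ?powR_ge0// invr_ge0 ltW.
- by rewrite mulr_ge0// mulr_ge0 ?exprn_ge0// ltW.
- rewrite -[leRHS]mul1r ler_pM ?divr_ge0 ?powR_ge0 ?invr_ge0 ?(ltW c1)//.
    rewrite ler_pdivrMr ?powR_gt0// mul1r ge0_ler_powR ?nnegrE ?(ltW c1) ?(ltW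
      z10) ?(ltW g_gt0)//.
    by rewrite lerD2l lerN2 ltW.
  by rewrite lef_pV2 ?posrE// lerD2l lerN2 ltW.
rewrite -[leRHS]mul1r; apply: ler_pM => //.
- by rewrite mulr_ge0 ?exprn_ge0 ?(ltW c0) ?(ltW z0).
- exact: binomial_coef_le1.
rewrite -[leRHS]mulr1 ler_pM ?exprn_ge0 ?(ltW c0) ?(ltW z0) ?(ltW z1)//.
by apply: lerXn2r; rewrite ?nnegrE ltW.
Qed.

Lemma binomial_sum_cvg z : 0 < z -> z < 1 ->
  binomial_sum K z @[K --> \oo] --> 1 - (1 - z) `^ g.
Proof.
move=> z0 z1.
have zK : z ^+ K @[K --> \oo] --> 0 by apply: cvg_expr; rewrite ger0_norm// ltW.
have up : 1 - (1 - z) `^ g - (1 - z)^-1 * z ^+ K @[K --> \oo] --> 1 - (1 - z)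
  `^ g.
  rewrite -[X in _ --> X]subr0 -[X in _ --> _ - X](mulr0 (1 - z)^-1).
  by apply: cvgB; [exact: cvg_cst|exact: cvgMl_tmp].
apply: squeeze_cvgr up (cvg_cst _); apply: nearW => K.
have /andP[lo hi] := binomial_sum_bounds K z0 z1.
by apply/andP; split; lra.
Qed.

Lemma binomial_sum1_nondecreasing : {homo binomial_sum^~ 1 : K K' / (K <=
  K')%N >-> K <= K'}.
Proof.
apply/nondecreasing_seqP => K.
by rewrite binomial_sumS lerDl mulr_ge0 ?binomial_coef_ge0// exprn_ge0.
Qed.

(** Abel's theorem at z = 1: the limit is at least 1 - (1 - z)^g for every
    z < 1, and z is taken so close to 1 that (1 - z)^g <= e. *)
Lemma binomial_sum1_cvg : binomial_sum K 1 @[K --> \oo] --> (1 : R).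
Proof.
have nd := binomial_sum1_nondecreasing.
have cv : cvgn (binomial_sum^~ 1).
  by apply: nondecreasing_is_cvgn => //; exists 1 => _ [K _ <-];
    exact: binomial_sum1.
suff L : limn (binomial_sum^~ 1) = 1 by rewrite -[X in _ --> X]L; exact: cv.
apply/eqP; rewrite eq_le; apply/andP; split.
  by apply: limr_le => //; apply: nearW => K; exact: binomial_sum1.
apply/ler_addgt0Pr => e e0.
pose y := Num.min (e `^ g^-1) 2^-1.
have y0 : 0 < y by rewrite lt_min powR_gt0//= invr_gt0.
have y1 : y <= 2^-1 by rewrite ge_min lexx orbT.
have ye : y `^ g <= e.
  have -> : e = (e `^ g^-1) `^ g by rewrite -powRrM mulVf ?gt_eqF// powRr1// ltW.
  by rewrite ge0_ler_powR ?nnegrE ?powR_ge0 ?(ltW g_gt0) ?(ltW y0)// ge_min lexx.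
have z0 : 0 < 1 - y by lra.
have z1 : 1 - y < 1 by lra.
rewrite -lerBlDr; apply: (@le_trans _ _ (1 - (1 - (1 - y)) `^ g)).
  by rewrite subKr lerD2l lerN2.
apply: (ler_cvg_to (binomial_sum_cvg z0 z1) cv); apply: nearW => K.
by apply: binomial_sum_le; exact: ltW.
Qed.

(** Partial sums of (1 - z)^g = sum_m a_m (1 - z^(m+1)).  In contrast to 1 - P(z)
    they vanish at z = 1 and increase to their limit. *)
Definition binomial_deficit K z : R := binomial_sum K 1 - binomial_sum K z.

Lemma binomial_deficit_cvg z : 0 <= z -> z <= 1 ->
  binomial_deficit K z @[K --> \oo] --> (1 - z) `^ g.
Proof.
move=> z0; rewrite le_eqVlt => /predU1P[->|z1].
  rewrite subrr powR0 ?gt_eqF//; under eq_fun do rewrite /binomial_deficit subrr.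
  exact: cvg_cst.
have [->|zn0] := eqVneq z 0.
  rewrite subr0 powR1 -[X in _ --> X]subr0; apply: cvgB;
    first exact: binomial_sum1_cvg.
  rewrite (_ : (fun K => _) = cst 0); first exact: cvg_cst.
  by apply/funext => K; rewrite /binomial_sum big1// => m _; rewrite expr0n mulr0.
rewrite -[X in _ --> X](subKr 1); apply: cvgB; first exact: binomial_sum1_cvg.
by apply: binomial_sum_cvg => //; rewrite lt_neqAle eq_sym zn0.
Qed.

Lemma binomial_deficit_ge0 K z : 0 <= z -> z <= 1 -> 0 <= binomial_deficit K z.
Proof. by move=> z0 z1; rewrite subr_ge0 binomial_sum_le. Qed.

Lemma binomial_deficit_le K z : 0 <= z -> z <= 1 -> binomial_deficit K z <=
  (1 - z) `^ g.
Proof.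
move=> z0 z1; have cv := binomial_deficit_cvg z0 z1.
rewrite -(cvg_lim _ cv)//; apply: (@nondecreasing_cvgn_le _ (binomial_deficit^~
  z)).
  apply/nondecreasing_seqP => m; rewrite /binomial_deficit !binomial_sumS.
  rewrite expr1n mulr1 -subr_ge0.
  rewrite (_ : _ - _ = binomial_coef m * (1 - z ^+ m.+1)); last by ring.
  by rewrite mulr_ge0 ?binomial_coef_ge0// subr_ge0 exprn_ile1.
by apply/cvg_ex; exists ((1 - z) `^ g).
Qed.

End binomial_series.

(** * Elementary limits *)

Section limits.
Context {R : realType}.

Lemma cvg_powR (u : nat -> R) (l r : R) : 0 < l -> u m @[m --> \oo] --> l ->
  u m `^ r @[m --> \oo] --> l `^ r.
Proof.
move=> l0 ul; have c : {for l, continuous (fun x : R => x `^ r)}.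
  apply/differentiable_continuous/derivable1_diffP.
  by apply: ex_derive; exact: (is_derive1_powR r l0).
exact: (continuous_cvg _ c ul).
Qed.

Lemma cvg_divSn (y : R) : y / m.+1%:R @[m --> \oo] --> 0.
Proof. by rewrite -(mulr0 y); apply: cvgMl_tmp; exact: cvg_harmonic. Qed.

Lemma cvg_difference_quotient (F : R -> R) (d y : R) : is_derive (0 : R) 1 F d ->
  m.+1%:R * (F (y / m.+1%:R) - F 0) @[m --> \oo] --> y * d.
Proof.
move=> [dF dE]; have [->|y0] := eqVneq y 0.
  rewrite mul0r (_ : (fun m => _) = cst 0); first exact: cvg_cst.
  by apply/funext => m; rewrite mul0r subrr mulr0.
have Fd : h^-1 * (F (h * 1 + 0) - F 0) @[h --> 0^'] --> d.
  by rewrite -dE; exact: dF.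
have /cvgr_dnbhsP := Fd => /(_ (fun m => y / m.+1%:R)) H.
have {}H := H (conj (fun m => mulf_neq0 y0 (invr_neq0 (lt0r_neq0 (ltr0Sn _
  m)))) (cvg_divSn y)).
rewrite (_ : (fun m => _) = (fun m => y *
  ((y / m.+1%:R)^-1 * (F ((y / m.+1%:R) * 1 + 0) - F 0)))).
  exact: cvgMl_tmp.
apply/funext => m; rewrite addr0 mulr1.
by rewrite mulrA; congr (_ * _); field; rewrite y0 addrC natr1 pnatr_eq0.
Qed.

Lemma cvg_expN (y : R) :
  m.+1%:R * (1 - expR (- (y / m.+1%:R))) @[m --> \oo] --> y.
Proof.
have := @cvg_difference_quotient _ _ (- y) (is_derive_expR 0).
rewrite expR0 mulr1 => H; rewrite -[X in _ --> X]opprK.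
rewrite (_ : (fun m => _) = (fun m => - (m.+1%:R * (expR (- y / m.+1%:R) - 1)))).
  exact: cvgN.
by apply/funext => m; rewrite mulNr; ring.
Qed.

Lemma cvg_sin (y : R) : m.+1%:R * sin (y / m.+1%:R) @[m --> \oo] --> y.
Proof.
have := @cvg_difference_quotient _ _ y (is_derive_sin 0); rewrite sin0 cos0 mulr1.
by under eq_fun do rewrite subr0.
Qed.

Lemma norm_sin_le (y : R) : `|sin y| <= `|y|.
Proof.
wlog y0 : y / 0 < y => [wl|].
  have [/wl //|yn|<-] := ltgtP 0 y; last by rewrite sin0.
  by rewrite -normrN -sinN -[leRHS]normrN; apply: wl; rewrite oppr_gt0.
have [|c _] := MVT y0 (fun x _ => is_derive_sin x).
  by apply: derivable_within_continuous => x _; apply: ex_derive.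
by rewrite sin0 !subr0 => ->; rewrite normrM -[leRHS]mul1r ler_wpM2r // cos_max.
Qed.

End limits.

(** * Subordination *)

Section subordination.
Context {R : realType} {n : nat} (g : R) (g_gt0 : 0 < g) (g_le1 : g <= 1).
Implicit Types (psi : 'rV[R]_n -> R).

(** The opposite of binomial_deficit is, up to a constant, a polynomial in exp
  (- psi) with
    nonnegative coefficients, and mixtures are closed under such polynomials and
    under the exponential. *)
Let mixture_deficit psi tau : (forall x, 0 <= psi x) -> 0 <= tau ->
  mixture (fun x => expR (- psi x)) ->
  mixture (fun x => expR (- (tau * (1 - expR (- psi x)) `^ g))).
Proof.
move=> psi0 tau0 mpsi.
apply: (@mixture_lim _ _ (fun K x =>
    expR (- (tau * binomial_deficit g K (expR (- psi x)))))); last first.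
  move=> x; apply: continuous_cvg; first exact: continuous_expR.
  apply: cvgN; apply: cvgMl_tmp; apply: binomial_deficit_cvg => //.
  by rewrite -expR0 ler_expR oppr_le0.
move=> K.
have mP : mixture (fun x => binomial_sum g K (expR (- psi x))).
  apply: mixture_sum => m; apply: mixtureZ; first exact: binomial_coef_ge0.
  exact: mixtureX.
apply: mixture_ext (mixtureZ (expR_ge0 (- (tau * binomial_sum g K 1)))
  (mixture_exp (mixtureZ tau0 mP))) => x /=.
by rewrite -expRD /binomial_deficit; congr expR; ring.
Qed.

(** psi^g is the limit of m^g (1 - exp (- psi / m))^g; this is Bochner's
    subordination by the g-stable subordinator, which is thereby approximated by
    compound Poisson processes. *)
Lemma mixture_subordination psi t : (forall x, 0 <= psi x) ->
  (forall s, 0 <= s -> mixture (fun x => expR (- (s * psi x)))) ->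
  0 <= t -> mixture (fun x => expR (- (t * psi x `^ g))).
Proof.
move=> psi0 mpsi t0.
apply: (@mixture_lim _ _ (fun m x => expR (- (t * m.+1%:R `^ g *
    (1 - expR (- (m.+1%:R^-1 * psi x))) `^ g)))).
  move=> m; apply: mixture_deficit.
  - by move=> x; rewrite mulr_ge0// invr_ge0.
  - by rewrite mulr_ge0// powR_ge0.
  - by apply: mpsi; rewrite invr_ge0.
move=> x; apply: continuous_cvg; first exact: continuous_expR.
apply: cvgN; under eq_fun do rewrite -mulrA.
apply: cvgMl_tmp.
have e1 m : expR (- (m.+1%:R^-1 * psi x)) <= 1.
  by rewrite -expR0 ler_expR oppr_le0 mulr_ge0// invr_ge0.
rewrite (_ : (fun m => _) =
  (fun m => (m.+1%:R * (1 - expR (- (psi x / m.+1%:R)))) `^ g)); last first.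
  by apply/funext => m; rewrite -powRM ?subr_ge0// [_^-1 * _]mulrC.
have [p0|pn0] := eqVneq (psi x) 0.
  rewrite p0 powR0 ?gt_eqF// (_ : (fun m => _) = cst 0); first exact: cvg_cst.
  by apply/funext => m; rewrite mul0r oppr0 expR0 subrr mulr0 powR0 ?gt_eqF.
have pos : 0 < psi x by rewrite lt_neqAle eq_sym pn0 psi0.
by have := @cvg_powR _ _ _ g pos (@cvg_expN _ (psi x)).
Qed.

End subordination.

(** * Integrals against du / u^2 *)

Section scale_integral.
Context {R : realType}.
Local Notation mu := (@lebesgue_measure R).

(** After the substitution u = exp s, the integral of phi u / u^2 over u > 0 is an
    integral over the line, for which scaling by r becomes the translation by
    ln r. *)
Definition scale_integrand (phi : R -> R) (s : R) : R :=
  phi (expR s) * expR (- s).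

Definition scale_integral (phi : R -> R) : R :=
  \int[mu]_(s in setT) scale_integrand phi s.

Definition scale_integrable (phi : R -> R) : Prop :=
  mu.-integrable setT (EFin \o scale_integrand phi).

Lemma integrable_exp_norm (q : R) : 0 < q ->
  mu.-integrable setT (EFin \o (fun s => expR (- (q * `|s|)))).
Proof.
move=> q0.
have cont : continuous (fun s : R => expR (- (q * `|s|))).
  move=> s; apply: continuous_comp; last exact: continuous_expR.
  by apply: cvgN; apply: cvgMl_tmp; exact: norm_continuous.
apply/integrableP; split.
  by apply/measurable_EFinP; exact: continuous_measurable_fun.
under eq_integral do rewrite /= ger0_norm ?expR_ge0//.
rewrite (ge0_symfun_integralT (fun s => expR_ge0 _) cont); last first.
  by move=> s /=; rewrite normrN.
have -> : (\int[mu]_(s in [set s | (0 <= s)%R]) (expR (- (q * `|s|)))%:E =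
    \int[mu]_(s in `[0%R, +oo[) (expR (- (q * s)))%:E)%E.
  rewrite -set_itvcy; apply: eq_integral => s.
  by rewrite inE/= in_itv/= andbT => s0; rewrite ger0_norm.
have dF (s : R) : is_derive s 1 (fun s => - q^-1 * expR (- q * s)) (expR (- (q
  * s))).
  have d1 : is_derive s 1 (fun s => - q * s) (- q).
    rewrite [X in is_derive _ _ _ X](_ : _ = (- q) *: 1);
      last by rewrite -[RHS]/(_ * _) mulr1.
    exact: is_deriveZ.
  have d2 := @is_derive1_comp _ expR _ _ _ _ (is_derive_expR _) d1.
  rewrite [X in is_derive _ _ _ X](_ : _ = (- q^-1) *: (expR (- q * s) * - q)).
    exact: is_deriveZ.
  by rewrite -[RHS]/(_ * _) (mulNr q s); field; rewrite gt_eqF.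
rewrite (@ge0_continuous_FTC2y _ _ (fun s => - q^-1 * expR (- q * s)) 0 0).
- by rewrite mulr0 expR0 mulr1 -EFinB -EFinM ltry.
- by move=> s _; exact: expR_ge0.
- apply/continuous_subspaceT => s; apply: continuous_comp;
  last exact: continuous_expR.
  by apply: cvgN; exact: cvgMl_tmp.
- rewrite -[X in _ --> X](mulr0 (- q^-1)); apply: cvgMl_tmp.
  under eq_fun do rewrite mulNr.
  apply: (@cvg_comp _ _ _ (fun s => q * s) (fun s => expR (- s)) _ +oo);
    last exact: cvgr_expR.
  by apply: gt0_cvgMry => //; exact: cvg_id.
- by move=> s _; apply: ex_derive.
- apply: cvg_at_right_filter.
  suff : {for (0 : R), continuous (fun s : R => - q^-1 * expR (- q * s))} by [].
  by apply/differentiable_continuous/derivable1_diffP; apply: ex_derive.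
- by move=> s _; rewrite derive1E; apply: derive_val.
Qed.


(** The bound phi <= B u^(1+q) gives integrability at u = 0, and the bound
    phi <= 2 at infinity. *)
Lemma scale_integrand_le (phi : R -> R) (q B : R) : 0 < q -> q <= 1 -> 0 <= B ->
  (forall u, 0 < u -> `|phi u| <= 2) ->
  (forall u, 0 < u -> `|phi u| <= B * u `^ (1 + q)) ->
  forall s, `|scale_integrand phi s| <= (B + 2) * expR (- (q * `|s|)).
Proof.
move=> q0 q1 B0 phi2 phiB s; rewrite /scale_integrand normrM (ger0_norm
  (expR_ge0 (- s))).
have [s0|s0] := ltP s 0.
  apply: (@le_trans _ _ (B * expR (- (q * `|s|)))); last first.
    by rewrite ler_wpM2r ?expR_ge0// lerDl.
  rewrite (ltr0_norm s0); apply: le_trans (ler_wpM2r (expR_ge0 _) (phiB _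
    (expR_gt0 _))) _.
  rewrite -mulrA ler_wpM2l// -expRM -expRD ler_expR.
  by rewrite le_eqVlt; apply/orP; left; apply/eqP; ring.
apply: (@le_trans _ _ (2 * expR (- (q * `|s|)))); last first.
  by rewrite ler_wpM2r ?expR_ge0// lerDr.
rewrite (ger0_norm s0); apply: ler_pM => //; first exact: phi2 (expR_gt0 _).
by rewrite ler_expR lerN2 -[leRHS]mul1r ler_wpM2r.
Qed.

Lemma scale_integrable_le (phi : R -> R) (q B : R) : 0 < q -> q <= 1 -> 0 <= B ->
  (forall u, 0 < u -> `|phi u| <= 2) ->
  (forall u, 0 < u -> `|phi u| <= B * u `^ (1 + q)) ->
  measurable_fun setT (scale_integrand phi) -> scale_integrable phi.
Proof.
move=> q0 q1 B0 phi2 phiB mphi.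
have B2 : 0 <= B + 2 by rewrite addr_ge0.
apply: (@le_integrable _ _ _ mu _ measurableT _
  (fun s => ((B + 2)%:E * (expR (- (q * `|s|)))%:E)%E)).
- exact/measurable_EFinP.
- move=> s _ /=; rewrite lee_fin [leRHS]ger0_norm ?mulr_ge0 ?expR_ge0//.
  exact: scale_integrand_le.
- by apply: integrableZl => //; exact: integrable_exp_norm.
Qed.

Lemma scale_integral_cvg (phi_ : nat -> R -> R) (phi : R -> R) (q B : R) :
  0 < q -> q <= 1 -> 0 <= B ->
  (forall m u, 0 < u -> `|phi_ m u| <= 2) ->
  (forall m u, 0 < u -> `|phi_ m u| <= B * u `^ (1 + q)) ->
  (forall m, measurable_fun setT (scale_integrand (phi_ m))) ->
  (forall u, 0 < u -> phi_ m u @[m --> \oo] --> phi u) ->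
  scale_integral (phi_ m) @[m --> \oo] --> scale_integral phi.
Proof.
move=> q0 q1 B0 phi2 phiB mphi cphi.
have cs s : scale_integrand (phi_ m) s @[m --> \oo] --> scale_integrand phi s.
  by apply: cvgMr_tmp; apply: cphi; exact: expR_gt0.
have mlim : measurable_fun setT (scale_integrand phi).
  by apply: (measurable_fun_cvg mphi) => s _; exact: cs.
have [|||||iphi _ lim] := @dominated_convergence _ _ _ mu _ measurableT
    (fun m => EFin \o scale_integrand (phi_ m)) (EFin \o scale_integrand phi)
    (fun s => ((B + 2)%:E * (expR (- (q * `|s|)))%:E)%E).
- by move=> m; apply/measurable_EFinP; exact: mphi.
- by apply/measurable_EFinP; exact: mlim.
- apply: aeW => s _; apply: cvg_EFin; first exact: nearW.
  exact: cs.
- by apply: integrableZl => //; exact: integrable_exp_norm.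
- apply: aeW => s m _ /=; rewrite lee_fin.
  by apply: scale_integrand_le => // u u0; [exact: phi2|exact: phiB].
rewrite /scale_integral /Rintegral; apply: fine_cvg; rewrite fineK.
  exact: lim.
exact: integrable_fin_num.
Qed.

Lemma scale_integrand_continuous (phi : R -> R) : continuous phi ->
  continuous (scale_integrand phi).
Proof.
move=> cphi s; apply: cvgM.
  by apply: (@continuous_comp _ _ _ expR phi);
    [exact: continuous_expR|exact: cphi].
by apply: (@continuous_comp _ _ _ -%R expR); [exact: opp_continuous|exact:
  continuous_expR].
Qed.

Lemma scale_integral_scale (phi : R -> R) (r : R) : 0 < r ->
  continuous (scale_integrand phi) ->
  (forall u, 0 < u -> 0 <= phi u) -> scale_integrable (fun u => phi (r * u)) ->
  scale_integral (fun u => phi (r * u)) = r * scale_integral phi.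
Proof.
move=> r0 cG phi0 iphi.
have G0 s : 0 <= scale_integrand phi s by rewrite mulr_ge0 ?expR_ge0// phi0//
  expR_gt0.
pose F s := s + ln r.
have dF (s : R) : is_derive s 1 F 1.
  by rewrite -[X in is_derive _ _ _ X]addr0; apply: is_deriveD.
have F1 : derive1 F = cst 1.
  by apply/funext => s; rewrite derive1E; apply: derive_val.
have e : (\int[mu]_s (scale_integrand phi s)%:E =
    \int[mu]_s (r^-1%:E * (scale_integrand (fun u => phi (r * u)) s)%:E))%E.
  rewrite (@increasing_ge0_integration_by_substitutionT _ F)//.
  - apply: eq_integral => s _; rewrite F1 -EFinM; congr _%:E.
    rewrite -[LHS]/(scale_integrand phi (F s) * 1) mulr1 /scale_integrand /F.
    rewrite opprD !expRD (expRN (ln r)) lnK ?posrE// [r * _]mulrC; ring.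
  - by move=> x y xy; rewrite ltrD2r.
  - by rewrite F1; exact: cst_continuous.
  - by rewrite F1; exact: is_cvg_cst.
  - by rewrite F1; exact: is_cvg_cst.
  - apply/cvgrNyPle => A; near=> s; rewrite /F -lerBrDr; near: s.
    by apply: nbhs_ninfty_le; exact: num_real.
  - apply/cvgryPge => A; near=> s; rewrite /F -lerBlDr; near: s.
    by apply: nbhs_pinfty_ge; exact: num_real.
rewrite /scale_integral /Rintegral.
rewrite e integralZl// fineM//; last exact: integrable_fin_num.
by rewrite mulrA divff ?mul1r// gt_eqF.
Unshelve. all: end_near. Qed.

(** The interval [0, 1] of the variable s, that is u in [1, e], already
    contributes c / e. *)
Lemma scale_integral_gt0 (phi : R -> R) (c : R) : 0 < c -> scale_integrable phi ->
  (forall u, 0 < u -> 0 <= phi u) -> (forall u, 1 <= u -> c <= phi u) ->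
  0 < scale_integral phi.
Proof.
move=> c0 iphi phi0 phic.
have fin := integrable_fin_num measurableT iphi.
rewrite /scale_integral /Rintegral -lte_fin fineK//.
have mphi := measurable_int _ iphi.
apply: (@lt_le_trans _ _ (\int[mu]_(s in `[0%R, 1%R]) (c * expR (-1))%:E)%E).
  rewrite integral_cst//= lebesgue_measure_itv/= lte_fin ltr01 oppr0 adde0 mule1.
  by rewrite lte_fin mulr_gt0// expR_gt0.
apply: (@le_trans _ _ (\int[mu]_(s in `[0%R, 1%R]) (scale_integrand phi s)%:E)%E).
  apply: ge0_le_integral => //.
  - by move=> s _; rewrite lee_fin mulr_ge0 ?expR_ge0// ltW.
  - exact: measurable_funTS.
  move=> s /=; rewrite in_itv/= => /andP[s0 s1]; rewrite lee_fin.
  apply: ler_pM; rewrite ?expR_ge0 ?(ltW c0)//.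
    by apply: phic; rewrite -expR0 ler_expR.
  by rewrite ler_expR lerN2.
apply: ge0_subset_integral => //.
by move=> s _; rewrite lee_fin mulr_ge0 ?expR_ge0// phi0// expR_gt0.
Qed.

End scale_integral.

(** * Zonoids and trigonometric polynomials *)

Section zonoid.
Context {R : realType} {n : nat}.
Implicit Types (x th : 'rV[R]_n) (rho f : 'rV[R]_n -> R).

(** Limits of finite sums of functions |dot th x|, that is, support functions of
    zonoids centred at the origin. *)
Inductive zonoid : ('rV[R]_n -> R) -> Prop :=
| zonoid_dot th : zonoid (fun x => `|dot th x|)
| zonoidD rho1 rho2 : zonoid rho1 -> zonoid rho2 ->
    zonoid (fun x => rho1 x + rho2 x)
| zonoid_lim (rho_ : nat -> 'rV[R]_n -> R) rho : (forall m, zonoid (rho_ m)) ->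
    (forall x, rho_ m x @[m --> \oo] --> rho x) -> zonoid rho.

Lemma zonoid_ext rho1 rho2 : rho1 =1 rho2 -> zonoid rho1 -> zonoid rho2.
Proof. by move=> /funext ->. Qed.

Lemma zonoidZ c rho : 0 <= c -> zonoid rho -> zonoid (fun x => c * rho x).
Proof.
move=> c0; elim=> {rho} [th|rho1 rho2 _ IH1 _ IH2|rho_ rho _ IH cv].
- by apply: zonoid_ext (zonoid_dot (c *: th)) => x;
  rewrite dotZl normrM ger0_norm.
- by apply: zonoid_ext (zonoidD IH1 IH2) => x; rewrite mulrDr.
- by apply: (zonoid_lim IH) => x; apply: cvgMl_tmp; exact: cv.
Qed.

Lemma zonoid_mixture rho : zonoid rho -> mixture (fun x => expR (- rho x)).
Proof.
elim=> {rho} [th|rho1 rho2 _ IH1 _ IH2|rho_ rho _ IH cv].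
- apply: mixture_ext (mixture_atom [:: th]) => x.
  by rewrite /hyperplane_norm big_seq1.
- by apply: mixture_ext (mixtureM IH1 IH2) => x; rewrite opprD expRD.
- apply: (mixture_lim IH) => x; apply: continuous_cvg;
  first exact: continuous_expR.
  by apply: cvgN; exact: cv.
Qed.

(** Trigonometric polynomials with nonnegative coefficients, the characteristic
    functions of finitely supported symmetric measures. *)
Inductive trig : ('rV[R]_n -> R) -> Prop :=
| trig_cos th : trig (fun x => cos (dot th x))
| trigZ c f : 0 <= c -> trig f -> trig (fun x => c * f x)
| trigD f1 f2 : trig f1 -> trig f2 -> trig (fun x => f1 x + f2 x).

Lemma trig_ext f1 f2 : f1 =1 f2 -> trig f1 -> trig f2.
Proof. by move=> /funext ->. Qed.

Lemma trig_cst c : 0 <= c -> trig (fun=> c).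
Proof.
move=> c0; apply: trig_ext (trigZ c0 (trig_cos 0)) => x.
by rewrite dot0l cos0 mulr1.
Qed.

Lemma trigM f1 f2 : trig f1 -> trig f2 -> trig (fun x => f1 x * f2 x).
Proof.
move=> + tf2; elim=> {f1} [th|c f c0 _ IH|f f' _ IH _ IH'].
- elim: tf2 => {f2} [th'|c f c0 _ IH|f f' _ IH _ IH'].
  + have h0 : 0 <= 2^-1 :> R by [].
    apply: trig_ext (trigZ h0 (trigD (trig_cos (th +
      th')) (trig_cos (th - th')))) => x.
    rewrite dotDl dotDl -scaleN1r dotZl mulN1r cosD cosB; lra.
  + by apply: trig_ext (trigZ c0 IH) => x; ring.
  + by apply: trig_ext (trigD IH IH') => x; ring.
- by apply: trig_ext (trigZ c0 IH) => x; ring.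
- by apply: trig_ext (trigD IH IH') => x; ring.
Qed.

Lemma trigX f m : trig f -> trig (fun x => f x ^+ m).
Proof.
move=> tf; elim: m => [|m IH]; first exact: trig_cst.
by apply: trig_ext (trigM tf IH) => x; rewrite exprS.
Qed.

Lemma trig_sum (I : Type) (r : seq I) (f : I -> 'rV[R]_n -> R) :
  (forall i, trig (f i)) -> trig (fun x => \sum_(i <- r) f i x).
Proof.
move=> tf; elim: r => [|i r IH].
  by apply: trig_ext (trig_cst (lexx 0)) => x; rewrite big_nil.
by apply: trig_ext (trigD (tf i) IH) => x; rewrite big_cons.
Qed.

Lemma trig_norm_le f x : trig f -> `|f x| <= f 0.
Proof.
elim=> {f} [th|c f c0 _ IH|f f' _ IH _ IH'].
- by rewrite dot0r cos0 cos_max.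
- by rewrite normrM ger0_norm// ler_wpM2l.
- by rewrite (le_trans (ler_normD _ _))// lerD.
Qed.

Lemma one_sub_cos_le (y : R) : 1 - cos y <= y ^+ 2.
Proof.
have -> : y = y / 2 + y / 2 by field.
rewrite cosD -!expr2 cos2sin2.
have : `|sin (y / 2)| ^+ 2 <= `|y / 2| ^+ 2.
  by apply: lerXn2r; rewrite ?nnegrE// norm_sin_le.
rewrite !real_normK ?num_real//; move: (sin (y / 2)) => s.
have : 0 <= (y / 2) ^+ 2 by rewrite sqr_ge0.
by lra.
Qed.

Definition deficit f x (u : R) : R := f 0 - f (u *: x).

Lemma deficit_cos_continuous (y : R) : continuous (fun u : R => 1 - cos (u * y)).
Proof.
move=> u; apply: cvgB; first exact: cvg_cst.
apply: (@continuous_comp _ _ _ (fun u : R => u * y) cos);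
  last exact: continuous_cos.
exact: cvgMr_tmp.
Qed.

Lemma deficit_cos_integrable (y : R) : scale_integrable (fun u =>
  1 - cos (u * y)).
Proof.
have d0 u : 0 <= 1 - cos (u * y) by rewrite subr_ge0 cos_le1.
apply: (@scale_integrable_le _ _ 1 (y ^+ 2)) => //.
- by rewrite sqr_ge0.
- move=> u u0; rewrite ger0_norm//; have := cos_geN1 (u * y); lra.
- move=> u u0; rewrite ger0_norm//; apply: le_trans (one_sub_cos_le _) _.
  by rewrite exprMn mulrC -[1 + 1]/(2%:R) powR_mulrn// ltW.
- apply: continuous_measurable_fun; apply: scale_integrand_continuous.
  exact: deficit_cos_continuous.
Qed.

(** For the characteristic function f of a measure m, the integral of
    (f 0 - f (u x)) / u^2 over u > 0 is, up to a constant, the integral of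
    |dot th x| against m.  The constant, the integral of (1 - cos u) / u^2, comes
    out by scaling and its value is immaterial. *)
Lemma trig_zonoid f : trig f ->
  (forall x, scale_integrable (deficit f x)) /\
  zonoid (fun x => scale_integral (deficit f x)).
Proof.
elim=> {f} [th|c f c0 _ [If Zf]|f f' _ [If Zf] _ [If' Zf']].
- have E x : deficit (fun x => cos (dot th x)) x = fun u =>
  1 - cos (u * dot th x).
    by apply/funext => u; rewrite /deficit dot0r cos0 dotZr.
  split; first by move=> x; rewrite E; exact: deficit_cos_integrable.
  pose c := scale_integral (fun u : R => 1 - cos u).
  have c0 : 0 <= c.
    apply: Rintegral_ge0 => s _; rewrite mulr_ge0 ?expR_ge0// subr_ge0;
      exact: cos_le1.
  apply: zonoid_ext (zonoidZ c0 (zonoid_dot th)) => x; rewrite E mulrC /c.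
  move: (dot th x) => y; have [->|y0] := eqVneq y 0.
    rewrite normr0 mul0r; apply/esym; rewrite /scale_integral /Rintegral.
    rewrite (eq_integral (cst 0%E)) ?integral0// => s _.
    by rewrite /scale_integrand mulr0 cos0 subrr mul0r.
  have -> : (fun u => 1 - cos (u * y)) = (fun u => 1 - cos (`|y| * u)).
    apply/funext => u; have [ypos|yneg] := leP 0 y;
      first by rewrite ger0_norm// mulrC.
    by rewrite ltr0_norm// mulNr cosN mulrC.
  rewrite (@scale_integral_scale _ (fun u => 1 - cos u))//.
  + by rewrite normr_gt0.
  + apply: scale_integrand_continuous => u.
    by apply: cvgB; [exact: cvg_cst|exact: continuous_cos].
  + have := deficit_cos_integrable `|y|; congr scale_integrable.
    by apply/funext => u; rewrite mulrC.
- have E x : scale_integrand (deficit (fun x => c * f x) x) =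
      (fun s => c * scale_integrand (deficit f x) s).
    by apply/funext => s; rewrite /scale_integrand /deficit -mulrBr mulrA.
  split.
    move=> x; rewrite /scale_integrable E.
    have := integrableZl measurableT c (If x).
    by apply: eq_integrable => // s _.
  apply: zonoid_ext (zonoidZ c0 Zf) => x.
  by rewrite /scale_integral E RintegralZl//; exact: If.
- have E x : scale_integrand (deficit (fun x => f x + f' x) x) =
      (fun s => scale_integrand (deficit f x) s +
        scale_integrand (deficit f' x) s).
    by apply/funext => s; rewrite /scale_integrand /deficit -mulrDl;
      congr (_ * _); ring.
  split.
    move=> x; rewrite /scale_integrable E.
    have := integrableD measurableT (If x) (If' x).
    by apply: eq_integrable => // s _.
  apply: zonoid_ext (zonoidD Zf Zf') => x.
  rewrite /scale_integral E RintegralD//; [exact: If|exact: If'].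
Qed.

End zonoid.

(** * The p-norm as the support function of a zonoid *)

Section exponential_limit.
Context {R : realType}.

Lemma bernoulli_le (y : R) m : `|y| <= 1 -> 1 - y ^+ m <= m%:R * (1 - y).
Proof.
move=> y1; have [ylo yhi] : -1 <= y /\ y <= 1 by apply/andP; rewrite -ler_norml.
rewrite -opprB subrX1 -mulNr opprB mulrC ler_wpM2r ?subr_ge0//.
rewrite -[leRHS]mulr1 -[m in leRHS]card_ord mulr_natl -sumr_const.
apply: ler_sum => i _; apply: le_trans (ler_norm _) _.
by rewrite normrX exprn_ile1.
Qed.

Lemma cvg_expr_exp (a : R) (m0 : nat) : 0 <= a -> a < m0%:R ->
  (1 - a / (m0 * m.+1)%:R) ^+ (m0 * m.+1) @[m --> \oo] --> expR (- a).
Proof.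
move=> a0 am.
have m00 : 0 < m0%:R :> R by exact: le_lt_trans am.
have ym m : 0 <= a / (m0 * m.+1)%:R by rewrite divr_ge0.
have y1 m : a / (m0 * m.+1)%:R < 1.
  rewrite ltr_pdivrMr ?natrM ?mulr_gt0// mul1r (lt_le_trans am)//.
  by rewrite ler_peMr ?ler1n// ltW.
apply: (@squeeze_cvgr _ _ _ _ (fun m => expR (- (a / (1 - a / (m0 * m.+1)%:R))))
   (cst (expR (- a)))); last 2 first.
- apply: continuous_cvg; first exact: continuous_expR.
  apply: cvgN; rewrite -[X in _ --> X]divr1; apply: cvgMl_tmp; apply: cvgV.
    exact: oner_neq0.
  rewrite -[X in _ --> X]subr0; apply: cvgB; first exact: cvg_cst.
  have := @cvg_divSn R (a / m0%:R).
  by under eq_fun do rewrite -mulrA -invfM -natrM.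
- exact: cvg_cst.
apply: nearW => m; move: (ym m) (y1 m); set y := a / _ => y0 {}y1.
have y10 : 0 < 1 - y by rewrite subr_gt0.
have my : a = (m0 * m.+1)%:R * y.
  by rewrite /y mulrC divfK// natrM mulf_neq0 ?gt_eqF.
clearbody y; rewrite /= {1 2}my -mulrA -[- (_ * (y / _))]mulrN -[- (_ *
  y)]mulrN !expRM_natl; apply/andP; split.
  apply: lerXn2r; rewrite ?nnegrE ?expR_ge0 ?(ltW y10)//.
  rewrite expRN invf_ple ?posrE ?expR_gt0//.
  apply: le_trans (expR_ge1Dx _).
  by rewrite le_eqVlt; apply/orP; left; apply/eqP; field; rewrite gt_eqF.
apply: lerXn2r; rewrite ?nnegrE ?expR_ge0 ?(ltW y10)//.
exact: expR_ge1Dx.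
Qed.

End exponential_limit.

Section lp_norm_zonoid.
Context {R : realType} {n : nat} (p : R) (p_gt1 : 1 < p) (p_le2 : p <= 2).
Implicit Types (x : 'rV[R]_n) (f : 'rV[R]_n -> R).

Let p_gt0 : 0 < p. Proof. exact: lt_trans p_gt1. Qed.

Definition power_sum x : R := \sum_(j < n) `|x ord0 j| `^ p.

Lemma power_sum_ge0 x : 0 <= power_sum x.
Proof. by rewrite sumr_ge0// => j _; rewrite powR_ge0. Qed.

Lemma power_sumZ u x : 0 <= u -> power_sum (u *: x) = u `^ p * power_sum x.
Proof.
move=> u0; rewrite /power_sum mulr_sumr; apply: eq_bigr => j _.
by rewrite mxE normrM ger0_norm// powRM.
Qed.

(** The bound by the power sum is part of the base case because it yields an
    integrable majorant for (1 - f (u x)) / u^2 near u = 0 that is common to all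
    functions in a limit; here p > 1 is essential. *)
Inductive dominated_trig : ('rV[R]_n -> R) -> Prop :=
| dominated_trig_base f : trig f -> f 0 = 1 ->
    (forall x, 1 - f x <= power_sum x) -> dominated_trig f
| dominated_trig_lim (f_ : nat -> 'rV[R]_n -> R) f :
    (forall m, dominated_trig (f_ m)) ->
    (forall x, f_ m x @[m --> \oo] --> f x) -> dominated_trig f.

Lemma dominated_trig_props f : dominated_trig f ->
  [/\ f 0 = 1, forall x, `|f x| <= 1, forall x, 1 - f x <= power_sum x,
    forall x, measurable_fun setT (scale_integrand (deficit f x)) &
    zonoid (fun x => scale_integral (deficit f x))].
Proof.
elim=> {f} [f tf f0 fp|f_ f _ IH cv].
  have [If Zf] := trig_zonoid tf; split => //.
    by move=> x; rewrite -f0; exact: trig_norm_le.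
  by move=> x; have /measurable_EFinP := measurable_int _ (If x).
have dcv x u : deficit (f_ m) x u @[m --> \oo] --> deficit f x u.
  by apply: cvgB; exact: cv.
have f1 x : `|f x| <= 1.
  have cn : `|f_ m x| @[m --> \oo] --> `|f x| by apply: cvg_norm; exact: cv.
  apply: (@ler_cvg_to _ _ _ _ _ (cst 1) _ _ cn); first exact: cvg_cst.
  by apply: nearW => m; have [_ + _ _ _] := IH m.
have f0 : f 0 = 1.
  have cv0 := cv 0; rewrite -(cvg_lim _ cv0)//.
  rewrite (_ : (fun m => _) = cst 1) ?lim_cst//.
  by apply/funext => m; have [] := IH m.
split => //.
- move=> x; have cB : 1 - f_ m x @[m --> \oo] --> 1 - f x by apply: cvgB;
  [exact: cvg_cst|exact: cv].
  apply: (@ler_cvg_to _ _ _ _ _ (cst (power_sum x)) _ _ cB); first exact: cvg_cst.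
  by apply: nearW => m; have [_ _ + _ _] := IH m.
- move=> x; apply: (@measurable_fun_cvg _ _ _ _ (fun m =>
  scale_integrand (deficit (f_ m) x))).
    by move=> m; have [_ _ _ + _] := IH m.
  by move=> s _; apply: cvgMr_tmp; exact: dcv.
apply: (@zonoid_lim _ _ (fun m x => scale_integral (deficit (f_ m) x))).
  by move=> m; have [] := IH m.
move=> x; apply: (@scale_integral_cvg _ _ _ (p - 1) (power_sum x)).
- by rewrite subr_gt0.
- by rewrite lerBlDr.
- exact: power_sum_ge0.
- move=> m u _; rewrite /deficit; have [-> H _ _ _] := IH m.
  by apply: le_trans (ler_normB _ _) _; rewrite normr1 -[2]/(1 + 1) lerD2l.
- move=> m u u0; rewrite /deficit; have [-> H P _ _] := IH m.
  rewrite ger0_norm; last by rewrite subr_ge0 (le_trans (ler_norm _)).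
  apply: le_trans (P _) _; rewrite power_sumZ ?(ltW u0)// mulrC.
  by rewrite [1 + _]addrC subrK.
- by move=> m; have [_ _ _ + _] := IH m.
- by move=> u _; exact: dcv.
Qed.

(** With N = m + 1, this is |2 N sin (y / 2N)|^p = (2N)^p (1 - cos^2)^(p/2), the
    power p/2 being replaced by a partial sum of its expansion in powers of
    cos^2.  It increases with K to a function below |y|^p, and a constant minus it
    is a trigonometric polynomial with nonnegative coefficients. *)
Definition sine_power (K m : nat) (y : R) : R :=
  (2 * m.+1%:R) `^ p * binomial_deficit (p / 2) K (cos (y / 2 / m.+1%:R) ^+ 2).

Lemma half_p_gt0 : 0 < p / 2. Proof. by rewrite divr_gt0. Qed.

Lemma half_p_le1 : p / 2 <= 1. Proof. by rewrite ler_pdivrMr// mul1r. Qed.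

Lemma cos2_ge0 (y : R) : 0 <= cos y ^+ 2. Proof. exact: sqr_ge0. Qed.

Lemma cos2_le1 (y : R) : cos y ^+ 2 <= 1.
Proof. by rewrite cos2sin2 gerBl sqr_ge0. Qed.

Lemma sine_powerE m (y : R) : (2 * m.+1%:R) `^ p *
    (1 - cos (y / 2 / m.+1%:R) ^+ 2) `^ (p / 2) =
  `|2 * (m.+1%:R * sin (y / 2 / m.+1%:R))| `^ p.
Proof.
rewrite -sin2cos2 -real_normK ?num_real// -powR_mulrn// -powRrM.
rewrite [2 * (p / 2)]mulrC divfK// -powRM// mulrA normrM [`|2 * _|]ger0_norm//.
Qed.

Lemma sine_power_ge0 K m y : 0 <= sine_power K m y.
Proof.
rewrite mulr_ge0 ?powR_ge0//.
by apply: (binomial_deficit_ge0 half_p_gt0 half_p_le1);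
  rewrite ?cos2_ge0 ?cos2_le1.
Qed.

Lemma sine_power_le K m y : sine_power K m y <= `|y| `^ p.
Proof.
apply: (@le_trans _ _ (`|2 * (m.+1%:R * sin (y / 2 / m.+1%:R))| `^ p)).
  rewrite -sine_powerE ler_wpM2l ?powR_ge0//.
  by apply: (binomial_deficit_le half_p_gt0 half_p_le1);
    rewrite ?cos2_ge0 ?cos2_le1.
rewrite ge0_ler_powR ?nnegrE ?(ltW p_gt0)// mulrA normrM.
apply: le_trans (ler_wpM2l (normr_ge0 _) (norm_sin_le _)) _.
by rewrite -normrM le_eqVlt; apply/orP; left; apply/eqP; congr `|_|; field;
  rewrite addrC natr1 pnatr_eq0.
Qed.

Lemma sine_power0 K m : sine_power K m 0 = 0.
Proof.
by rewrite /sine_power !mul0r cos0 expr1n /binomial_deficit subrr mulr0.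
Qed.

Lemma sine_power_cvg m y :
  sine_power K m y @[K --> \oo] --> `|2 * (m.+1%:R * sin (y / 2 / m.+1%:R))| `^ p.
Proof.
rewrite -sine_powerE; apply: cvgMl_tmp.
by apply: (binomial_deficit_cvg half_p_gt0 half_p_le1);
  rewrite ?cos2_ge0 ?cos2_le1.
Qed.

Lemma sine_cvg y : `|2 * (m.+1%:R * sin (y / 2 / m.+1%:R))| `^ p @[m --> \oo]
  --> `|y| `^ p.
Proof.
have [->|y0] := eqVneq y 0.
  rewrite normr0 (_ : (fun m => _) = cst (0 `^ p)); first exact: cvg_cst.
  by apply/funext => m; rewrite !mul0r sin0 !mulr0 normr0.
apply: cvg_powR; first by rewrite normr_gt0.
have : `|2 * (m.+1%:R * sin (y / 2 / m.+1%:R))| @[m --> \oo] --> `|2 * (y / 2)|.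
  by apply: cvg_norm; apply: cvgMl_tmp; exact: cvg_sin.
by rewrite [2 * (y / 2)]mulrC divfK.
Qed.

(** exp (- S) is the limit of (1 - S / M)^M, and 1 - S / M is a trigonometric
    polynomial with nonnegative coefficients as soon as M is at least the
    constant c. *)
Lemma dominated_trig_sine_power K m :
  dominated_trig (fun x => expR (- \sum_(j < n) sine_power K m (x ord0 j))).
Proof.
set S := fun x => \sum_(j < n) sine_power K m (x ord0 j).
pose c : R := \sum_(j < n) (2 * m.+1%:R) `^ p * binomial_sum (p / 2) K 1.
pose T x := \sum_(j < n) (2 * m.+1%:R) `^ p *
  binomial_sum (p / 2) K (cos (x ord0 j / 2 / m.+1%:R) ^+ 2).
have ST x : S x = c - T x.
  by rewrite /S /c /T -sumrB; apply: eq_bigr => j _; rewrite -mulrBr.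
have tT : trig T.
  apply: trig_sum => j; apply: trigZ; first exact: powR_ge0.
  apply: trig_sum => k; apply: trigZ.
    by apply: binomial_coef_ge0; rewrite ?half_p_gt0 ?half_p_le1.
  apply: trigX; apply: trigX.
  apply: trig_ext (trig_cos ((2^-1 / m.+1%:R) *: delta_mx ord0 j)) => x.
  by rewrite dotC dot_delta -mulrA mulrC.
have S0 x : 0 <= S x by rewrite sumr_ge0// => j _; exact: sine_power_ge0.
have T0 x : 0 <= T x.
  rewrite sumr_ge0// => j _; rewrite mulr_ge0 ?powR_ge0//.
  by apply: binomial_sum_ge0; rewrite ?half_p_gt0 ?half_p_le1 ?cos2_ge0.
pose m0 := (Num.truncn c).+1.
have cm0 : c < m0%:R by exact: truncnS_gt.
have m00 : 0 < m0%:R :> R by [].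
apply: (@dominated_trig_lim (fun k x => (1 - S x / (m0 * k.+1)%:R) ^+ (m0 *
  k.+1))); last first.
  by move=> x; apply: cvg_expr_exp => //; apply: le_lt_trans cm0;
    rewrite ST gerBl.
move=> k; have M0 : 0 < (m0 * k.+1)%:R :> R by rewrite natrM mulr_gt0.
have cM : c / (m0 * k.+1)%:R <= 1.
  rewrite ler_pdivrMr// mul1r natrM (le_trans (ltW cm0))//.
  by rewrite ler_peMr ?ler1n// ltW.
set M := (m0 * k.+1)%N in M0 cM *.
have tb : trig (fun x => 1 - S x / M%:R).
  have Mi : 0 <= M%:R^-1 :> R by rewrite invr_ge0 ltW.
  have cc : 0 <= 1 - c / M%:R by rewrite subr_ge0.
  apply: trig_ext (trigD (trig_cst cc) (trigZ Mi tT)) => x.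
  by rewrite ST; ring.
have b0 : 1 - S 0 / M%:R = 1.
  rewrite /S big1 ?mul0r ?subr0// => j _.
  by rewrite mxE sine_power0.
apply: dominated_trig_base.
- exact: trigX.
- by rewrite b0 expr1n.
move=> x; apply: le_trans (bernoulli_le _ _) _.
  by have := trig_norm_le x tb; rewrite b0.
rewrite subKr mulrC divfK ?gt_eqF//.
by apply: ler_sum => j _; exact: sine_power_le.
Qed.

Lemma dominated_trig_exp_power_sum :
  dominated_trig (fun x => expR (- power_sum x)).
Proof.
apply: (@dominated_trig_lim (fun m x => expR (- \sum_(j < n)
  `|2 * (m.+1%:R * sin (x ord0 j / 2 / m.+1%:R))| `^ p))); last first.
  move=> x; apply: continuous_cvg; first exact: continuous_expR.
  by apply: cvgN; apply: cvg_sumr => j; exact: sine_cvg.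
move=> m; apply: (dominated_trig_lim (fun K =>
  dominated_trig_sine_power K m)) => x.
apply: continuous_cvg; first exact: continuous_expR.
by apply: cvgN; apply: cvg_sumr => j; exact: sine_power_cvg.
Qed.

(** Levy's embedding of l_p^n into L_1.  The characteristic function
    f = exp (- ||x||_p^p) depends on ||x||_p only, so that the integral of
    (1 - f (u x)) / u^2 is a constant multiple of ||x||_p by scaling. *)
Lemma zonoid_lp_norm : zonoid (@lp_norm R n p).
Proof.
have [_ _ _ mf Zf] := dominated_trig_props dominated_trig_exp_power_sum.
pose phi (u : R) : R := 1 - expR (- u `^ p).
have phi0 u : 0 <= phi u by rewrite subr_ge0 -expR0 ler_expR oppr_le0 powR_ge0.
have phi1 u : `|phi u| <= 1.
  by rewrite ger0_norm// gerBl expR_ge0.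
have phip u : 0 < u -> `|phi u| <= 1 * u `^ (1 + (p - 1)).
  move=> u0; rewrite ger0_norm// mul1r [1 + _]addrC subrK.
  by have := expR_ge1Dx (- u `^ p); rewrite /phi; lra.
have cphi : continuous (scale_integrand phi).
  rewrite (_ : scale_integrand phi = fun s =>
    (1 - expR (- expR (s * p))) * expR (- s)).
    have ce (h : R -> R) : continuous h -> continuous (fun s => expR (h s)).
      by move=> ch s; apply: continuous_comp; [exact: ch|exact: continuous_expR].
    have cN (h : R -> R) : continuous h -> continuous (fun s => - h s).
      by move=> ch s; apply: cvgN; exact: ch.
    have cid : continuous (fun s : R => s) by move=> s; exact: cvg_id.
    have cM : continuous (fun s : R => s * p) by move=> s; exact: cvgMr_tmp.
    move=> s; apply: cvgM; last exact: (ce _ (cN _ cid) s).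
    by apply: cvgB; [exact: cvg_cst|exact: (ce _ (cN _ (ce _ cM)) s)].
  by apply/funext => s; rewrite /scale_integrand /phi expRM.
have le12 : 1 <= 2 :> R by rewrite ler1n.
have iphi r : 0 < r -> scale_integrable (fun u => phi (r * u)).
  move=> r0; apply: (@scale_integrable_le _ _ (p - 1) (r `^ p)).
  - by rewrite subr_gt0.
  - by rewrite lerBlDr.
  - exact: powR_ge0.
  - by move=> u _; exact: le_trans (phi1 _) le12.
  - move=> u u0; apply: le_trans (phip _ (mulr_gt0 r0 u0)) _.
    by rewrite mul1r powRM ?(ltW r0) ?(ltW u0)// [1 + _]addrC subrK.
  apply: continuous_measurable_fun.
  have -> : scale_integrand (fun u => phi (r * u)) =
      (fun s => r * scale_integrand phi (s + ln r)).
    apply/funext => s; rewrite /scale_integrand opprD !expRD (expRN (ln r)) lnK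
      ?posrE//.
    by rewrite [expR s * r]mulrC; field; rewrite gt_eqF.
  move=> s; apply: cvgMl_tmp.
  apply: (@continuous_comp _ _ _ (fun s => s + ln r)); last exact: cphi.
  by apply: cvgD; [exact: cvg_id|exact: cvg_cst].
have c0 : 0 < scale_integral phi.
  apply: (@scale_integral_gt0 _ _ 2^-1) => //.
    by have := iphi 1 ltr01; congr scale_integrable; apply/funext => u;
      rewrite mul1r.
  move=> u u1; have : 1 <= u `^ p.
    have <- : (1 : R) `^ p = 1 by rewrite powR1.
    by rewrite ge0_ler_powR ?nnegrE ?(ltW p_gt0)// (le_trans _ u1).
  move=> up; have : expR (- u `^ p) <= 2^-1.
    rewrite expRN lef_pV2 ?posrE ?expR_gt0//.
    by apply: le_trans (expR_ge1Dx _); lra.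
  by rewrite /phi; lra.
have ci : 0 <= (scale_integral phi)^-1 by rewrite invr_ge0 ltW.
apply: zonoid_ext (zonoidZ ci Zf) => x.
have rp : lp_norm p x `^ p = power_sum x by exact: lp_norm_powR.
have -> : scale_integral (deficit (fun x => expR (- power_sum x)) x) =
    scale_integral (fun u => phi (lp_norm p x * u)).
  congr Rintegral; apply/funext => s; congr (_ * _); rewrite /deficit /phi.
  rewrite power_sumZ ?expR_ge0// powRM ?expR_ge0 ?lp_norm_ge0// rp mulrC.
  by rewrite -{1}(scale0r 0) power_sumZ// powR0 ?gt_eqF// mul0r oppr0 expR0.
have [->|r0] := eqVneq (lp_norm p x) 0.
  rewrite [X in _ * X](_ : _ = 0) ?mulr0// /scale_integral /Rintegral.
  rewrite (eq_integral (cst 0%E)) ?integral0// => s _.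
  by rewrite /scale_integrand /phi mul0r powR0 ?gt_eqF// oppr0 expR0 subrr mul0r.
have {}r0 : 0 < lp_norm p x by rewrite lt_neqAle eq_sym r0 lp_norm_ge0.
rewrite scale_integral_scale//; last exact: iphi.
by rewrite mulrCA mulVf ?mulr1// gt_eqF.
Qed.

End lp_norm_zonoid.

(** * The kernels of l_p spaces *)

Section lp_kernels.
Context {R : realType} {n : nat} (p a : R).
Hypotheses (p_gt0 : 0 < p) (p_le2 : p <= 2) (a_gt0 : 0 < a) (a_le1 : a <= 1).

Let beta : R := a * Num.min 1 p.

Let beta_gt0 : 0 < beta.
Proof. by rewrite mulr_gt0// lt_min ltr01. Qed.

(** For p > 1, ||.||_p is the support function of a zonoid.  For p <= 1,
    ||x||_p^(a p) = (sum_j |x_j|^p)^a, where each exp (- s |x_j|^p) is subordinate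
    to exp (- s |x_j|).  In both cases the power a is a subordination. *)
Lemma mixture_lp_kernel t : 0 <= t ->
  mixture (fun x : 'rV[R]_n => expR (- (t * lp_norm p x `^ beta))).
Proof.
move=> t0; rewrite /beta; have [p_ge1|p1] := leP p 1; last first.
  rewrite mulr1; apply: mixture_subordination => // [x|s s0].
    exact: lp_norm_ge0.
  apply: zonoid_mixture; apply: zonoidZ => //; exact: zonoid_lp_norm.
apply: mixture_ext (mixture_subordination a_gt0 a_le1
  (psi := fun x => \sum_(j < n) `|x ord0 j| `^ p) _ _ t0) => [x|x|s s0] /=.
- by rewrite -(lp_norm_powR x p_gt0) -(powRrM _ p a) [p * a]mulrC.
- by rewrite sumr_ge0// => j _; exact: powR_ge0.
apply: (@mixture_ext _ _ (fun x => \prod_(j < n) expR (- (s * `|x ord0 j| `^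
  p)))).
  by move=> x; rewrite -expR_sum mulr_sumr -sumrN.
apply: mixture_prod => j; apply: mixture_subordination => // r r0.
apply: zonoid_mixture; apply: zonoidZ => //.
apply: zonoid_ext (zonoid_dot (delta_mx ord0 j)) => x.
by rewrite dotC -[delta_mx _ _]scale1r dot_delta mul1r.
Qed.

Lemma lp_norm_delta (c : R) j : 0 <= c ->
  lp_norm p (c *: delta_mx ord0 j : 'rV[R]_n) = c.
Proof.
move=> c0; rewrite /lp_norm (bigD1 j)//= big1 ?addr0.
  by rewrite !mxE !eqxx mulr1 ger0_norm// -powRrM divff ?gt_eqF// powRr1.
by move=> i ij; rewrite !mxE (negPf ij) andbF mulr0 normr0 powR0// gt_eqF.
Qed.

(** With M = (4 n t)^(1 / beta) the kernel k is exp (- 1 / 4n) at e_l / M, so that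
    the factor k 0 - 2 sum_l (k 0 - k (e_l / M)) of [mixture_form] is at least
    1/2; the other factor is of order M^n, that is, t^(n / beta). *)
Lemma lp_kernel_form (L : R) : (0 < n)%N -> 0 <= L ->
  exists2 C : R, 0 < C &
    forall (t : R) (I : finType) (w : I -> R) (x : I -> 'rV[R]_n), 1 <= t ->
      (forall i j k, `|x i ord0 k - x j ord0 k| <= L) ->
      (\sum_i w i) ^+ 2 <= C * t `^ (n%:R / beta) *
        \sum_i \sum_j w i * w j * expR (- (t * lp_norm p (x i - x j) `^ beta)).
Proof.
move=> n_gt0 L0; pose c : R := (4 * n%:R) `^ beta^-1.
have n0 : 0 < n%:R :> R by rewrite ltr0n.
have c0 : 0 < c by rewrite powR_gt0// mulr_gt0.
pose b := 1 + L * (n%:R * c).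
have b0 : 0 < b by rewrite ltr_pwDl// !mulr_ge0// ltW.
exists (2 * b ^+ n); first by rewrite mulr_gt0// exprn_gt0.
move=> t I w x t1 xL.
have t0 : 0 < t by apply: lt_le_trans t1.
pose r := t `^ beta^-1.
have r1 : 1 <= r.
  have <- : (1 : R) `^ beta^-1 = 1 by rewrite powR1.
  by rewrite ge0_ler_powR ?nnegrE ?invr_ge0 ?(ltW beta_gt0) ?(ltW t0).
have r0 : 0 < r by apply: lt_le_trans r1.
have M0 : 0 < c * r by rewrite mulr_gt0.
have := mixture_form w xL L0 M0 (mixture_lp_kernel (ltW t0)).
set k := fun x => expR _; rewrite -/(form w x k).
have k0 : k 0 = 1 by rewrite /k lp_norm0// powR0 ?gt_eqF// mulr0 oppr0 expR0.
have kd l : 1 - k ((c * r)^-1 *: delta_mx ord0 l) <= (4 * n%:R)^-1.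
  have Mb : ((c * r)^-1) `^ beta = ((4 * n%:R) * t)^-1.
    rewrite -powR_inv1 ?(ltW M0)// -powRrM mulN1r powRN; congr _^-1.
    rewrite powRM ?(ltW c0) ?(ltW r0)// -!powRrM mulVf ?gt_eqF//.
    by rewrite !powRr1 ?mulr_ge0// ltW.
  rewrite /k lp_norm_delta ?invr_ge0 ?(ltW M0)// Mb.
  have -> : t * ((4 * n%:R) * t)^-1 = (4 * n%:R)^-1.
    by field; rewrite (gt_eqF t0) (gt_eqF n0).
  by rewrite lerBlDr -lerBlDl; exact: expR_ge1Dx.
have half : 2^-1 <= k 0 - 2 * \sum_(l < n) (k 0 - k ((c * r)^-1 *: delta_mx
  ord0 l)).
  rewrite k0; have : \sum_(l < n) (1 - k ((c * r)^-1 *: delta_mx ord0 l)) <= 4^-1.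
    apply: le_trans (ler_sum _ (fun l _ => kd l)) _.
    rewrite sumr_const card_ord -mulr_natr le_eqVlt; apply/orP; left; apply/eqP.
    by field; rewrite gt_eqF.
  by lra.
have D0 : 0 < 1 + L * (n%:R * (c * r)).
  by rewrite ltr_pwDl// !mulr_ge0// ltW.
set D := 1 + _ in D0 *; set W := (\sum_i w i) ^+ 2.
have W0 : 0 <= W by exact: sqr_ge0.
have Db : D ^+ n <= b ^+ n * t `^ (n%:R / beta).
  have -> : t `^ (n%:R / beta) = r ^+ n.
    by rewrite -powR_mulrn ?(ltW r0)// /r -powRrM mulrC.
  rewrite -exprMn; apply: lerXn2r; rewrite ?nnegrE ?mulr_ge0 ?(ltW D0) ?(ltW
    b0) ?(ltW r0)//.
  by rewrite /D /b mulrDl mul1r; apply: lerD => //; rewrite !mulrA.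
move=> H; have {}H : W / D ^+ n * 2^-1 <= form w x k.
  by apply: le_trans H; rewrite ler_wpM2l// divr_ge0// exprn_ge0// ltW.
have DN0 : 0 < D ^+ n by rewrite exprn_gt0.
have F0 : 0 <= form w x k by apply: le_trans H;
  rewrite mulr_ge0 ?divr_ge0 ?(ltW DN0).
have : W <= 2 * D ^+ n * form w x k.
  have := ler_wpM2l (ltW (mulr_gt0 (ltr0Sn R 1) DN0)) H.
  have cancel (u v : R) : 0 < u -> 2 * u * (v / u * 2^-1) = v.
    by move=> u0; field; rewrite gt_eqF.
  by rewrite cancel.
move/le_trans; apply; rewrite -/(form w x k) ler_wpM2r//.
by rewrite -mulrA ler_wpM2l.
Qed.

End lp_kernels.

(** * From charges to finite configurations *)

Section bounded_integrals.
Context {d : measure_display} {T : measurableType d} {R : realType}.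
Implicit Types (f g : T -> R) (nu : {finite_measure set T -> \bar R}).

Definition bounded_measurable f : Prop :=
  measurable_fun setT f /\ exists b, forall x, `|f x| <= b.

Lemma bounded_measurable_integrable nu f : bounded_measurable f ->
  nu.-integrable setT (EFin \o f).
Proof.
move=> [mf [b fb]].
apply: (le_integrable measurableT _ _ (finite_measure_integrable_cst nu b
  measurableT)).
  exact/measurable_EFinP.
by move=> x _ /=; rewrite lee_fin (le_trans (fb x))// ler_norm.
Qed.

Lemma bounded_measurableB f g : bounded_measurable f -> bounded_measurable g ->
  bounded_measurable (fun x => f x - g x).
Proof.
move=> [mf [b fb]] [mg [c gc]]; split; first exact: measurable_funB.
by exists (b + c) => x; rewrite (le_trans (ler_normB _ _))// lerD.
Qed.

Lemma Rintegral_le_bound nu f e : bounded_measurable f ->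
  (forall x, `|f x| <= e) -> `|\int[nu]_x f x| <= e * fine (nu setT).
Proof.
move=> bf fe; have If := bounded_measurable_integrable nu bf.
apply: le_trans (le_normr_Rintegral measurableT If) _.
rewrite -Rintegral_cst//; apply: le_Rintegral => //.
- have [mf [b fb]] := bf; apply: bounded_measurable_integrable; split.
    by apply: measurableT_comp.
  by exists b => x; rewrite normr_id.
- exact: finite_measure_integrable_cst.
Qed.

Section finitely_many_values.
Context {I : finType} (c : T -> I).
Hypothesis mc : forall i, measurable (c @^-1` [set i]).

Lemma indic_sum (v : I -> R) x : v (c x) = \sum_i v i * \1_(c @^-1` [set i]) x.
Proof.
rewrite (bigD1 (c x))//= indicE mem_set// mulr1 big1 ?addr0// => i ic.
rewrite indicE memNset ?mulr0//= => ci; move: ic.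
by rewrite ci eqxx.
Qed.

Lemma finite_values_bounded_measurable (v : I -> R) :
  bounded_measurable (fun x => v (c x)).
Proof.
split; last first.
  exists (\sum_i `|v i|) => x.
  by rewrite (bigD1 (c x))//= lerDl sumr_ge0.
rewrite (_ : (fun x => _) =
  (fun x => \sum_(i <- index_enum I) v i * \1_(c @^-1` [set i]) x)); last first.
  by apply/funext => x; exact: indic_sum.
apply: measurable_sum => i; apply: measurable_funM; first exact: measurable_cst.
exact: measurable_indic.
Qed.

Lemma Rintegral_finite_values nu (v : I -> R) :
  \int[nu]_x v (c x) = \sum_i v i * fine (nu (c @^-1` [set i])).
Proof.
rewrite /Rintegral.
rewrite (eq_integral (fun x => \sum_(i <- index_enum I)
  ((v i)%:E * (\1_(c @^-1` [set i]) x)%:E)%E)%E); last first.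
  by move=> x _; rewrite indic_sum -sumEFin.
have ii i : nu.-integrable setT (EFin \o \1_(c @^-1` [set i])).
  apply: bounded_measurable_integrable; split; first exact: measurable_indic.
  by exists 1 => x; rewrite indicE; case: (_ \in _); rewrite ?normr1 ?normr0.
have iv i : nu.-integrable setT
    (fun x => ((v i)%:E * (\1_(c @^-1` [set i]) x)%:E)%E).
  by apply: integrableZl => //; exact: ii.
rewrite integral_sum//.
rewrite -sum_fine; last first.
  by move=> i _; apply: integrable_fin_num => //; exact: iv.
apply: eq_bigr => i _; rewrite (integralZl measurableT (ii i)) -[X in (_ *
  X)%E]/(\int[nu]_x (\1_(c @^-1` [set i]) x)%:E)%E integral_indic// setIT fineM//.
by rewrite fin_num_measure.
Qed.

End finitely_many_values.
End bounded_integrals.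

Section charge_integrals.
Context {d : measure_display} {T : measurableType d} {R : realType}.
Variable mu : {charge set T -> \bar R}.
Implicit Types (f g : T -> R).

Definition total_variation : R :=
  fine (jordan_pos (Hahn_choice mu) setT) + fine (jordan_neg (Hahn_choice mu)
    setT).

Lemma total_variation_ge0 : 0 <= total_variation.
Proof. by rewrite addr_ge0// fine_ge0. Qed.

(** Stability under uniform perturbations of the integrand is what allows passing
    from charges to finitely supported ones. *)
Lemma charge_integral_close f g e : bounded_measurable f ->
  bounded_measurable g ->
  (forall x, `|f x - g x| <= e) ->
  `|charge_integral mu f - charge_integral mu g| <= e * total_variation.
Proof.
move=> bf bg fge; have bfg := bounded_measurableB bf bg.
have If (nu : {finite_measure set T -> \bar R}) :=
  bounded_measurable_integrable nu bf.
have Ig (nu : {finite_measure set T -> \bar R}) :=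
  bounded_measurable_integrable nu bg.
rewrite /charge_integral.
rewrite (_ : _ - _ - _ =
    \int[jordan_pos (Hahn_choice mu)]_x (f x - g x) -
    \int[jordan_neg (Hahn_choice mu)]_x (f x - g x)); last first.
  rewrite (RintegralB measurableT (If (jordan_pos _)) (Ig (jordan_pos _))).
  rewrite (RintegralB measurableT (If (jordan_neg _)) (Ig (jordan_neg _))).
  by rewrite !opprB addrACA [RHS]addrACA; congr (_ + _); exact: addrC.
rewrite (le_trans (ler_normB _ _))// mulrDr.
by apply: lerD; exact: Rintegral_le_bound.
Qed.

Lemma charge_integral_le f b : bounded_measurable f -> (forall x, `|f x| <= b) ->
  `|charge_integral mu f| <= b * total_variation.
Proof.
move=> bf fb; rewrite (le_trans (ler_normB _ _))// mulrDr.
by apply: lerD; exact: Rintegral_le_bound.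
Qed.

Section finitely_many_values.
Context {I : finType} (c : T -> I).
Hypothesis mc : forall i, measurable (c @^-1` [set i]).

Lemma charge_integral_finite_values (v : I -> R) :
  charge_integral mu (fun x => v (c x)) =
  \sum_i v i * fine (mu (c @^-1` [set i])).
Proof.
rewrite /charge_integral !Rintegral_finite_values// -sumrB.
apply: eq_bigr => i _; rewrite -mulrBr; congr (_ * _).
rewrite (jordan_decomp (Hahn_choice mu) (mc i)) /cadd/= cscaleN1.
by rewrite fineB// fin_num_measure.
Qed.

End finitely_many_values.
End charge_integrals.

Section discretisation.
Context {R : realType} (T : metricType R) (x0 : T).
Variable mu : {charge set (borel x0) -> \bar R}.

Let K (x y : T) : R := expR (- mdist x y).
Let tv : R := total_variation mu.

Lemma expRN_lipschitz (a b : R) : 0 <= a -> 0 <= b ->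
  `|expR (- a) - expR (- b)| <= `|a - b|.
Proof.
wlog ab : a b / a <= b => [wl a0 b0|a0 b0].
  have [ab|/ltW ba] := leP a b; first exact: wl.
  by rewrite distrC [leRHS]distrC; exact: wl.
rewrite ger0_norm ?subr_ge0 ?ler_expR ?lerN2// ler0_norm ?subr_le0// opprB.
have -> : expR (- b) = expR (- a) * expR (- (b - a)).
  by rewrite -expRD; congr expR; ring.
rewrite -{1}[expR (- a)]mulr1 -mulrBr.
have h1 : expR (- a) <= 1 by rewrite -expR0 ler_expR oppr_le0.
have h2 := expR_ge1Dx (- (b - a)).
have h3 : 0 <= 1 - expR (- (b - a)).
  by rewrite subr_ge0 -expR0 ler_expR oppr_le0 subr_ge0.
apply: (@le_trans _ _ (1 * (1 - expR (- (b - a))))); first by rewrite ler_wpM2r.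
by rewrite mul1r; lra.
Qed.

Lemma kernel_lipschitz x y y' : `|K x y - K x y'| <= mdist y y'.
Proof.
apply: le_trans (expRN_lipschitz (mdist_ge0 _ _) (mdist_ge0 _ _)) _.
rewrite ler_norml lerBlDr lerNl opprB lerBlDr; apply/andP; split.
  by rewrite addrC metric_triangle.
by rewrite addrC (metric_sym y y') metric_triangle.
Qed.

Lemma kernelC x y : K x y = K y x.
Proof. by rewrite /K metric_sym. Qed.

Lemma lipschitz_measurable (f : borel x0 -> R) (c : R) : 0 <= c ->
  (forall y y' : T, `|f y - f y'| <= c * mdist y y') -> measurable_fun setT f.
Proof.
move=> c0 fl; apply: (measurability _ (RGenOInfty.measurableE R)).
move=> _ [_ [a ->] <-]; rewrite setTI.
suff oA : open (f @^-1` `]a, +oo[ : set T) by exact: sub_sigma_algebra.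
rewrite openE => y /=; rewrite in_itv/= andbT => ay.
apply/nbhs_ballP; exists ((f y - a) / (c + 1)) => /=.
  by rewrite divr_gt0 ?subr_gt0// ltr_pwDr.
move=> z; rewrite ballEmdist/= in_itv/= andbT => yz.
have c1 : 0 < c + 1 by rewrite ltr_pwDr.
move: yz; rewrite ltr_pdivlMr// => yz.
have := fl y z; rewrite ler_norml => /andP[_].
have : 0 <= mdist y z := mdist_ge0 y z.
by move: yz; rewrite mulrDr mulr1 mulrC; lra.
Qed.

Lemma kernel_bounded_measurable x : bounded_measurable (K x : borel x0 -> R).
Proof.
split; last first.
  exists 1 => y; rewrite ger0_norm ?expR_ge0// -expR0 ler_expR oppr_le0.
  exact: mdist_ge0.
by apply: (@lipschitz_measurable _ 1) => // y y'; rewrite mul1r;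
  exact: kernel_lipschitz.
Qed.

Section cells.
Context {I : finType} (c : borel x0 -> I) (x : I -> T) (e : R).
Hypothesis mc : forall i, measurable (c @^-1` [set i]).
Hypothesis xc : forall y : T, mdist (x (c y)) y <= e.

Let w i : R := fine (mu (c @^-1` [set i])).

(** The charge is moved to the points x i, cell by cell.  The kernel is
    1-Lipschitz in each variable, so moving either variable by at most e changes
    the double integral by at most e tv^2. *)
Lemma Zform_discretisation :
  `|Zform mu mu - \sum_i \sum_j w i * w j * K (x i) (x j)| <= 2 * e * tv ^+ 2.
Proof.
have e0 : 0 <= e by apply: le_trans (xc x0); exact: mdist_ge0.
have tv0 : 0 <= tv := total_variation_ge0 mu.
pose G (y : borel x0) := charge_integral mu (fun z : borel x0 => K z y).
have KC y : (fun z : borel x0 => K z y) = K y by apply/funext => z;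
  exact: kernelC.
have Gl (y y' : T) : `|G y - G y'| <= tv * mdist y y'.
  rewrite /G !KC mulrC; apply: charge_integral_close.
  - exact: kernel_bounded_measurable.
  - exact: kernel_bounded_measurable.
  - by move=> z; rewrite kernelC (kernelC y'); exact: kernel_lipschitz.
have bG : bounded_measurable G.
  split; first exact: lipschitz_measurable Gl.
  exists (1 * tv) => y; rewrite /G KC; apply: charge_integral_le.
    exact: kernel_bounded_measurable.
  move=> z; rewrite ger0_norm ?expR_ge0// -expR0 ler_expR oppr_le0.
  exact: mdist_ge0.
have outer : `|Zform mu mu - \sum_j G (x j) * w j| <= e * tv ^+ 2.
  rewrite -(charge_integral_finite_values mu mc (fun j => G (x j))).
  rewrite expr2 mulrA [e * _]mulrC; apply: charge_integral_close => //.
    exact: (finite_values_bounded_measurable mc (fun j => G (x j))).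
  move=> y; apply: le_trans (Gl _ _) _.
  by rewrite ler_wpM2l// metric_sym; exact: xc.
have inner j : `|G (x j) - \sum_i K (x i) (x j) * w i| <= e * tv.
  rewrite /G KC -(charge_integral_finite_values mu mc (fun i => K (x i) (x j))).
  apply: charge_integral_close.
  - exact: kernel_bounded_measurable.
  - exact: (finite_values_bounded_measurable mc (fun i => K (x i) (x j))).
  move=> y; rewrite (kernelC (x (c y))); apply: le_trans (kernel_lipschitz _ _
    _) _.
  by rewrite metric_sym; exact: xc.
have wtv : \sum_j `|w j| <= tv.
  have mass (nu : {finite_measure set (borel x0) -> \bar R}) :
      \sum_i fine (nu (c @^-1` [set i])) = fine (nu setT).
    rewrite -[RHS]mul1r -Rintegral_cst// (Rintegral_finite_values mc nu (fun=>
      1)).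
    by apply: eq_bigr => i _; rewrite mul1r.
  rewrite /tv /total_variation -!mass -big_split/=; apply: ler_sum => i _.
  rewrite /w (jordan_decomp (Hahn_choice mu) (mc i)) /cadd/= cscaleN1.
  rewrite fineB ?fin_num_measure//; apply: le_trans (ler_normB _ _) _.
  by rewrite !ger0_norm ?fine_ge0.
set S := \sum_i _.
have SE : \sum_j (G (x j) - \sum_i K (x i) (x j) * w i) * w j =
    \sum_j G (x j) * w j - S.
  under eq_bigr do rewrite mulrBl; rewrite sumrB; congr (_ - _).
  rewrite /S exchange_big/=; apply: eq_bigr => j _.
  by rewrite mulr_suml; apply: eq_bigr => i _; ring.
have -> : Zform mu mu - S = (Zform mu mu - \sum_j G (x j) * w j) +
    \sum_j (G (x j) - \sum_i K (x i) (x j) * w i) * w j.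
  by rewrite SE addrA subrK.
apply: le_trans (ler_normD _ _) _.
rewrite -mulrA mulrDl mul1r; apply: lerD => //.
apply: le_trans (ler_norm_sum _ _ _) _.
apply: (@le_trans _ _ (\sum_j e * tv * `|w j|)).
  by apply: ler_sum => j _; rewrite normrM ler_wpM2r.
by rewrite -mulr_sumr expr2 mulrA ler_wpM2l// mulr_ge0.
Qed.

Lemma sum_weights : \sum_i w i = fine (mu setT).
Proof.
transitivity (charge_integral mu (fun=> 1)).
  rewrite (charge_integral_finite_values mu mc (fun=> 1)).
  by apply: eq_bigr => i _; rewrite mul1r.
rewrite /charge_integral !Rintegral_cst// !mul1r.
rewrite [in RHS](jordan_decomp (Hahn_choice mu) measurableT) /cadd/= cscaleN1.
by rewrite fineB// fin_num_measure.
Qed.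

End cells.

(** Sending y to the first centre whose e-ball contains it makes the cells
    disjoint and Borel. *)
Lemma measurable_nearest (s : seq T) (e : R) : s != [::] ->
  (forall y : T, exists2 z, z \in s & mdist z y < e) ->
  exists c : borel x0 -> 'I_(size s),
    (forall i, measurable (c @^-1` [set i])) /\
    (forall y : T, mdist (nth x0 s (c y)) y <= e).
Proof.
move=> s0 se; pose near_y (y : T) z := mdist z y < e.
have fs (y : T) : (find (near_y y) s < size s)%N.
  by rewrite -has_find; apply/hasP; have [z zs zy] := se y; exists z.
exists (fun y => Ordinal (fs y)); split; last first.
  move=> y /=; have := nth_find x0 (_ : has (near_y y) s).
  by rewrite has_find => /(_ (fs y))/ltW.
have mb (z : T) : measurable ([set y : T | near_y y z] : set (borel x0)).
  apply: sub_sigma_algebra; rewrite /= openE => y /= zy.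
  apply/nbhs_ballP; exists (e - mdist z y) => /=; first by rewrite subr_gt0.
  move=> y'; rewrite ballEmdist/= ltrBrDl => yy'.
  exact: le_lt_trans (metric_triangle _ _ _) yy'.
have mfind k : measurable ([set y : T | find (near_y y) s = k] : set (borel x0)).
  move: {fs se s0} s k; elim=> [|z s IH] k /=.
    have [->|k0] := eqVneq k 0%N.
      by rewrite (_ : [set _ | _] = setT)//; apply/seteqP; split.
    rewrite (_ : [set _ | _] = set0)//; apply/seteqP; split => // y /= /esym k0'.
    by rewrite k0' eqxx in k0.
  case: k => [|k].
    rewrite (_ : [set _ | _] = [set y : T | near_y y z])//.
    by apply/seteqP; split => y /=; case: ifP.
  rewrite (_ : [set _ | _] =
    ~` [set y : T | near_y y z] `&` [set y : T | find (near_y y) s = k]).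
    by apply: measurableI; [apply: measurableC|exact: IH].
  apply/seteqP; split => y /=; case: (near_y y z) => //.
  - by case=> ->; split.
  - by case=> /(_ isT).
  - by case=> _ ->.
move=> i; rewrite (_ : _ @^-1` _ = [set y : T | find (near_y y) s = i]);
  first exact: mfind.
by apply/seteqP; split => y /=; [move=> <-|move=> yi; exact: val_inj].
Qed.

(** Moving the charge preserves its total mass exactly, hence the inequality for
    finitely supported charges passes to the limit. *)
Lemma charge_mass_bound (D : R) : 0 <= D ->
  (forall e : R, 0 < e ->
     exists2 s : seq T, s != [::] & forall y :
       T, exists2 z, z \in s & mdist z y < e) ->
  (forall m (w : 'I_m -> R) (x : 'I_m -> T),
     (\sum_i w i) ^+ 2 <= D * \sum_i \sum_j w i * w j * expR (- mdist (x i) (x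
       j))) ->
  fine (mu setT) ^+ 2 <= D * Zform mu mu.
Proof.
move=> D0 tb fin; apply/ler_addgt0Pr => e e0.
(* The error D * 2 d tv^2 is below e; the 1 covers tv = 0. *)
pose d := e / (D * 2 * tv ^+ 2 + 1).
have tv2 : 0 <= D * 2 * tv ^+ 2 by rewrite mulr_ge0 ?sqr_ge0// mulr_ge0.
have d0 : 0 < d by rewrite divr_gt0// ltr_pwDr.
have [s s0 sd] := tb d d0.
have [c [mc cd]] := measurable_nearest s0 sd.
have := @Zform_discretisation _ c (fun i => nth x0 s i) d mc cd.
have := fin _ (fun i => fine (mu (c @^-1` [set i]))) (fun i => nth x0 s i).
rewrite sum_weights//; set S := \sum_i _ => SD.
rewrite ler_norml => /andP[H _].
apply: (le_trans SD).
have : D * S <= D * (Zform mu mu + 2 * d * tv ^+ 2).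
  by rewrite ler_wpM2l//; move: H; lra.
move/le_trans; apply; rewrite mulrDr lerD2l.
rewrite (_ : D * _ = (D * 2 * tv ^+ 2) * d); last by ring.
by rewrite /d mulrA ler_pdivrMr ?ltr_pwDr// mulrC ler_wpM2l ?(ltW e0)// lerDl.
Qed.

End discretisation.

(** * Compact subsets of l_p spaces *)

Lemma le_sum_mem2 (R : realType) (E : eqType) (F : E -> E -> R) (s : seq E) u v :
  (forall x y, 0 <= F x y) -> u \in s -> v \in s ->
  F u v <= \sum_(x <- s) \sum_(y <- s) F x y.
Proof.
move=> F0 us vs; rewrite (big_rem u)//= (big_rem v)//= -addrA lerDl.
by rewrite addr_ge0// ?sumr_ge0// => x _; rewrite ?sumr_ge0.
Qed.

Lemma compact_net (R : realType) (X : metricType R) (A : set X) (e : R) :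
  compact A -> 0 < e ->
  exists s : seq (set_type A),
    forall y : set_type A, exists2 z : set_type A,
      z \in s & mdist (set_val z) (set_val y) < e.
Proof.
move=> cA e0; have [[x Ax]|A0] := pselect (A !=set0); last first.
  by exists [::] => y; case: A0; exists (set_val y); exact: set_valP.
pose PX := HB.pack_for ptopologicalType X (isPointed.Build X x).
have {}cA : @cover_compact PX A by rewrite -compact_cover.
have [||D' D'A cover] := cA X A (fun z => (ball z e)^°).
- by move=> z _; exact: open_interior.
- by move=> z Az; exists z => //; exact: nbhsx_ballx.
exists (pmap insub (finmap.enum_fset D')) => y.
have [z zD'] := cover (set_val y) (set_valP y).
move=> /interior_subset; rewrite ballEmdist/= => zy.
have zA : z \in A by apply: D'A.
exists (SigSub zA) => //.
by rewrite mem_pmap_sub.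
Qed.

Section lp_space_bounds.
Context {R : realType} (n : nat) (p a : R).
Context (p_gt0 : 0 < p) (a_gt0 : 0 < a) (a_le1 : a <= 1).
Local Notation X := (lp_space n p_gt0 a_gt0 a_le1).

Lemma coord_le_lp_norm (x : 'rV[R]_n) k : `|x ord0 k| <= lp_norm p x.
Proof.
have -> : `|x ord0 k| = (`|x ord0 k| `^ p) `^ p^-1.
  by rewrite -powRrM divff ?gt_eqF// powRr1.
rewrite /lp_norm ge0_ler_powR ?nnegrE ?invr_ge0 ?powR_ge0 ?(ltW p_gt0)//.
  by rewrite sumr_ge0// => j _; exact: powR_ge0.
by rewrite (bigD1 k)//= lerDl sumr_ge0// => j _; exact: powR_ge0.
Qed.

Lemma compact_coord_bounded (A : set X) : compact A ->
  exists2 L : R, 0 <= L & forall x y : 'rV[R]_n, A x -> A y ->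
    forall k, `|x ord0 k - y ord0 k| <= L.
Proof.
move=> cA; have [s cov] := compact_net cA ltr01.
pose beta := a * Num.min 1 p.
have beta0 : 0 < beta by rewrite mulr_gt0// lt_min ltr01.
pose D := \sum_(z <- s) \sum_(z' <- s) mdist (set_val z) (set_val z').
exists ((1 + D + 1) `^ beta^-1) => [|x y Ax Ay k]; first exact: powR_ge0.
have [z zs zx] := cov (SigSub (mem_set Ax)).
have [z' zs' zy] := cov (SigSub (mem_set Ay)).
have zz' : mdist (set_val z) (set_val z') <= D.
  by apply: (@le_sum_mem2 _ _ (fun z z' => mdist (set_val z) (set_val z'))) => //;
    move=> u v; exact: mdist_ge0.
have xy : mdist (x : X) (y : X) <= 1 + D + 1.
  apply: le_trans (metric_triangle _ (set_val z') _) _; apply: lerD (ltW zy).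
  apply: le_trans (metric_triangle _ (set_val z) _) _; apply: lerD zz'.
  by rewrite metric_sym; exact: ltW zx.
have -> : x ord0 k - y ord0 k = (x - y) ord0 k by rewrite !mxE.
apply: le_trans (coord_le_lp_norm _ _) _.
have -> : lp_norm p (x - y) = (lp_norm p (x - y) `^ beta) `^ beta^-1.
  by rewrite -powRrM divff ?gt_eqF// powRr1// lp_norm_ge0.
apply: ge0_ler_powR; rewrite ?nnegrE ?invr_ge0 ?powR_ge0 ?(ltW beta0)//.
by apply: le_trans xy; exact: mdist_ge0.
Qed.

End lp_space_bounds.

Theorem theorem4p4 (R : realType) (n : nat) (n_gt0 : (0 < n)%N) (p a : R)
    (p_gt0 : 0 < p) (p_le2 : p <= 2) (a_gt0 : 0 < a) (a_le1 : a <= 1)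
    (A : set (lp_space n p_gt0 a_gt0 a_le1)) (A0 : A !=set0) (cA : compact A) :
  exists2 C : R, 0 < C &
    forall (t : R) (t_gt0 : 0 < t), 1 <= t ->
      (magnitude (scaled t_gt0 (set_type A))
         <= (C * t `^ (n%:R / (a * Num.min 1 p)))%:E)%E.
Proof.
have [L L0 AL] := compact_coord_bounded cA.
have [C C0 CL] := lp_kernel_form p_gt0 p_le2 a_gt0 a_le1 n_gt0 L0.
exists C => // t t_gt0 t1; apply: ge_ereal_sup => _ [x0 [mu [Z0 ->]]].
set D := C * _; have D0 : 0 < D by rewrite mulr_gt0// powR_gt0.
have bound : fine (mu setT) ^+ 2 <= D * Zform mu mu.
  apply: charge_mass_bound; first exact: ltW.
    move=> e e0; have [s cov] := compact_net cA (divr_gt0 e0 t_gt0).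
    exists s; first by have [z] := cov x0; case: (s).
    move=> y; have [z zs zy] := cov y; exists z => //.
    by rewrite scaled_mdistE mulrC -ltr_pdivlMr.
  move=> m w x; have xL i j k :
      `|(set_val (x i : set_type A) : 'rV[R]_n) ord0 k -
        (set_val (x j : set_type A) : 'rV[R]_n) ord0 k| <= L.
    by apply: AL; exact: set_valP.
  exact: CL t1 xL.
have Zpos : 0 < Zform mu mu.
  rewrite lt_neqAle eq_sym Z0/= -(pmulr_rge0 _ D0).
  by apply: le_trans bound; exact: sqr_ge0.
by rewrite lee_fin ler_pdivrMr.
Qed.
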